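(* If $\omega$ is a regular frequency, then, as $\varepsilon\to0$ along the sequence $(\varepsilon_j)$ occurring in the definition of a regular frequency (up to a subsequence), $$\lim_{\varepsilon\to0}\|\mathcal P^r_\varepsilon-\mathcal P^r\|_{\mathscr L(L^2_{per}(\mathbb R))}=0\quad\text{and}\quad\lim_{\varepsilon\to0}\|\mathcal S^r_\varepsilon-\mathcal S^r\|_{\mathscr L(L^2_{per}(\mathbb R))}=0.$$ Moreover, the pair $(P,S)=(\mathcal P^r,\mathcal S^r)\in\mathscr L(L^2_{per}(\mathbb R))^2$ solves the Riccati system $$P=\mathcal T^{r,01}+\mathcal T^{r,11}S,\qquad S=\mathcal T^{r,00}P+\mathcal T^{r,10}SP.$$
   Context: Periodic coefficients. $\mu_p,\rho_p:\mathbb R^2\to\mathbb R$ are continuous, $1$-periodic in each variable and bounded below by positive constants; $(\theta_1,\theta_2)\in\mathbb R^2$ with $\theta_2>0$ and $\delta:=\theta_1/\theta_2$ irrational; $z>0$; $\omega\in\mathbb R$. For $s\in\mathbb R$ put $\mu_s(x):=\mu_p(s+\theta_1x,\theta_2x)$, $\rho_s(x):=\rho_p(s+\theta_1x,\theta_2x)$. Equations $-(\mu u')'-\rho\kappa u=0$ are understood weakly for $u\in H^1$, so that $u$ and $\mu u'$ have point values. Standing assumptions. The irrationality measure $m(\delta):=\sup\{\nu>0:\ |\delta-p/q|\le q^{-\nu}\text{ for infinitely many }(p,q)\in\mathbb Z\times\mathbb N^*\}$ is finite and $\mu_p,\rho_p\in C^m(\mathbb R^2)$ for some integer $m>m(\delta)$.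 Also $\omega^2\in\sigma(\mathcal A_\theta)$, where $\mathcal A_\theta u=-\frac1{\rho_0}(\mu_0u')'$ with domain $\{u\in H^1(\mathbb R):\mu_0u'\in H^1(\mathbb R)\}$ is self-adjoint in $L^2(\mathbb R;\rho_0\,dx)$ ($\mu_0,\rho_0$ are $\mu_s,\rho_s$ at $s=0$). Robin operators. $R^r_{\pm,s}u:=\mp\mu_su'-izu$, $R^l_{\pm,s}u:=\pm\mu_su'-izu$. Function space and winding number. $L^2_{per}(\mathbb R)$: $1$-periodic functions in $L^2_{loc}(\mathbb R)$, with the $L^2(0,1)$ inner product. $\mathcal N_{per}$: continuous $1$-periodic functions $f:\mathbb R\to\mathbb C$ that never vanish; writing $f=|f|e^{i\,\mathrm{Arg} f}$ with $\mathrm{Arg} f$ continuous on $\mathbb R$, $\mathbf w(f):=(\mathrm{Arg} f(1)-\mathrm{Arg} f(0))/2\pi$. Fundamental eigenpairs for $\varepsilon>0$. $u^r_{s,\varepsilon}\in H^1(0,\infty)$ and $u^l_{s,\varepsilon}\in H^1(-\infty,0)$ are the unique solutions of $-(\mu_su')'-\rho_s(\omega^2+i\varepsilon)u=0$ with $R^r_{+,s}u^r_{s,\varepsilon}(0)=1$, $R^l_{+,s}u^l_{s,\varepsilon}(0)=1$. Put $p^r_\varepsilon(s)=R^r_{+,s}u^r_{s,\varepsilon}(1/\theta_2)$, $\boldsymbol s^r_\varepsilon(s)=R^r_{-,s}u^r_{s,\varepsilon}(1/\theta_2)$, $p^l_\varepsilon(s)=R^l_{+,s}u^l_{s,\varepsilon}(-1/\theta_2)$,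 $\boldsymbol s^l_\varepsilon(s)=R^l_{-,s}u^l_{s,\varepsilon}(-1/\theta_2)$, and define on $L^2_{per}(\mathbb R)$: $\mathcal P^r_\varepsilon\varphi(s)=p^r_\varepsilon(s-\delta)\varphi(s-\delta)$, $\mathcal S^r_\varepsilon\varphi(s)=\boldsymbol s^r_\varepsilon(s-\delta)\varphi(s-\delta)$, $\mathcal P^l_\varepsilon\varphi(s)=p^l_\varepsilon(s+\delta)\varphi(s+\delta)$, $\mathcal S^l_\varepsilon\varphi(s)=\boldsymbol s^l_\varepsilon(s+\delta)\varphi(s+\delta)$. For $i\in\{l,r\}$ there is a unique pair $(\lambda^i_{0,\varepsilon},\varphi^i_{0,\varepsilon})\in\mathbb C\times\mathcal N_{per}$ with $|\lambda^i_{0,\varepsilon}|<1$, $\mathbf w(\varphi^i_{0,\varepsilon})=0$, $\varphi^i_{0,\varepsilon}(0)=1$ and $\mathcal P^i_\varepsilon\varphi^i_{0,\varepsilon}=\lambda^i_{0,\varepsilon}\varphi^i_{0,\varepsilon}$; put $\psi^i_{0,\varepsilon}:=\mathcal S^i_\varepsilon\varphi^i_{0,\varepsilon}$. Cell symbols without absorption. $e^{r,0}_s,e^{r,1}_s\in H^1(0,1/\theta_2)$ solve $-(\mu_su')'-\rho_s\omega^2u=0$ on $(0,1/\theta_2)$ with $R^r_{+,s}e^{r,0}_s(0)=1,\ R^r_{-,s}e^{r,0}_s(1/\theta_2)=0$ and $R^r_{+,s}e^{r,1}_s(0)=0,\ R^r_{-,s}e^{r,1}_s(1/\theta_2)=1$;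 $t^{r,00}(s)=R^r_{-,s}e^{r,0}_s(0)$, $t^{r,01}(s)=R^r_{+,s}e^{r,0}_s(1/\theta_2)$, $t^{r,10}(s)=R^r_{-,s}e^{r,1}_s(0)$, $t^{r,11}(s)=R^r_{+,s}e^{r,1}_s(1/\theta_2)$. Likewise $e^{l,0}_s,e^{l,1}_s\in H^1(-1/\theta_2,0)$ solve the same equation on $(-1/\theta_2,0)$ with $R^l_{+,s}e^{l,0}_s(0)=1,\ R^l_{-,s}e^{l,0}_s(-1/\theta_2)=0$ and $R^l_{+,s}e^{l,1}_s(0)=0,\ R^l_{-,s}e^{l,1}_s(-1/\theta_2)=1$; $t^{l,00}(s)=R^l_{-,s}e^{l,0}_s(0)$, $t^{l,10}(s)=R^l_{-,s}e^{l,1}_s(0)$. Local RtR operators on $L^2_{per}(\mathbb R)$: $\mathcal T^{r,00}\varphi(s)=t^{r,00}(s)\varphi(s)$, $\mathcal T^{r,01}\varphi(s)=t^{r,01}(s-\delta)\varphi(s-\delta)$, $\mathcal T^{r,10}\varphi(s)=t^{r,10}(s)\varphi(s+\delta)$, $\mathcal T^{r,11}\varphi(s)=t^{r,11}(s-\delta)\varphi(s)$. Flux density. With $\delta^r:=\delta$, $\delta^l:=-\delta$, $$Q^i_s(\varphi,\psi):=\mathrm{Re}\Big\{\big[(1-t^{i,00}(s))\varphi(s)-t^{i,10}(s)\psi(s+\delta^i)\big]\,\overline{\big[(1+t^{i,00}(s))\varphi(s)+t^{i,10}(s)\psi(s+\delta^i)\big]}\Big\}.$$ Regular frequency. $\omega$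 is regular if: (a) there is a sequence $\varepsilon_j\to0^+$ such that for each $i\in\{l,r\}$, along it, $\lambda^i_{0,\varepsilon}\to\lambda^i_0$ in $\mathbb C$ and $\varphi^i_{0,\varepsilon}\to\varphi^i_0$, $\psi^i_{0,\varepsilon}\to\psi^i_0$ uniformly on $\mathbb R$, for some $\lambda_0^i\in\mathbb C$ and continuous $1$-periodic $\varphi_0^i,\psi_0^i$; (b) for each $i$, $Q^i_0\ne0$, where $Q^i_0\ge 0$ is the value of $Q^i_s(\varphi^i_0,\psi^i_0)$, which is independent of $s$. (When $\omega$ is regular, $\varphi^i_0$ never vanishes.) Limit operators. $\mathcal P^r\varphi(s)=\boldsymbol p^r(s-\delta)\varphi(s-\delta)$ with $\boldsymbol p^r(s)=\lambda^r_0\,\varphi^r_0(s+\delta)/\varphi^r_0(s)$; $\mathcal S^r\varphi(s)=\boldsymbol s^r(s-\delta)\varphi(s-\delta)$ with $\boldsymbol s^r(s)=\psi^r_0(s+\delta)/\varphi^r_0(s)$. *)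

(* Defs.v *)
From HB Require Import structures.
From mathcomp Require Import all_boot all_order all_algebra.
From mathcomp Require Import complex.
From mathcomp Require Import all_classical all_reals all_analysis.

Set Implicit Arguments.
Unset Strict Implicit.
Unset Printing Implicit Defensive.
Import Order.TTheory GRing.Theory Num.Theory numFieldNormedType.Exports.
Local Open Scope classical_set_scope.
Local Open Scope ring_scope.
Local Open Scope complex_scope.

(* [R[i]] carries no topology in the library; this gives it the one induced by
   its norm, which exists for every [numFieldType] seen as [_^o]. *)
HB.instance Definition _ (R : realType) :=
  PseudoMetricNormedZmod.copy R[i] (R[i]^o).

Section Coefficients.
Context {R : realType}.

Definition periodic_coefficient (f : R * R -> R) : Prop :=
  [/\ continuous f,
      forall x y, f (x + 1, y) = f (x, y),
      forall x y, f (x, y + 1) = f (x, y) &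
      exists2 c : R, 0 < c & forall xy, c <= f xy].

Fixpoint Ck2 (k : nat) (f : R * R -> R) : Prop :=
  continuous f /\
  if k is k'.+1 then
    [/\ forall xy, derivable f xy (1, 0),
        forall xy, derivable f xy (0, 1),
        Ck2 k' (fun xy => 'D_(1, 0) f xy) &
        Ck2 k' (fun xy => 'D_(0, 1) f xy)]
  else True.

Definition irrationality_measure (d : R) : \bar R :=
  ereal_sup [set nu%:E | nu in [set nu : R | 0 < nu /\
    infinite_set [set pq : int * nat | (0 < pq.2)%N /\
      `|d - pq.1%:~R / pq.2%:R| <= pq.2%:R `^ (- nu)]]].

(* The one-dimensional coefficients [mu_s], [rho_s]. *)
Definition coef (theta1 theta2 : R) (f : R * R -> R) (s x : R) : R :=
  f (s + theta1 * x, theta2 * x).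

End Coefficients.

Section WeakSolutions.
Context {R : realType}.
Local Notation C := R[i].
Local Notation leb := (@lebesgue_measure R).

Definition cmeasurable (I : set R) (f : R -> C) : Prop :=
  measurable_fun I (fun x => complex.Re (f x)) /\ measurable_fun I (fun x => complex.Im (f x)).

Definition cintegral (I : set R) (f : R -> C) : C :=
  (\int[leb]_(x in I) complex.Re (f x)) +i* (\int[leb]_(x in I) complex.Im (f x)).

(* The norm of L^2(I; w dx). *)
Definition L2norm (w : R -> R) (I : set R) (f : R -> C) : \bar R :=
  sqrte (\int[leb]_(x in I) (w x * Normc.normc (f x) ^+ 2)%:E)%E.

Definition L2 (w : R -> R) (I : set R) (f : R -> C) : Prop :=
  cmeasurable I f /\ (L2norm w I f < +oo)%E.

(* C^1 functions with compact support in the open interval [I]. *)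
Definition test_function (I : set R) (phi : R -> R) : Prop :=
  [/\ forall x, derivable phi x 1,
      continuous (derive1 phi) &
      exists a b : R, `[a, b] `<=` I /\ forall x, x \notin `[a, b] -> phi x = 0].

(* [u] belongs to H^1(I) and [du] is its weak derivative. *)
Definition H1 (I : set R) (u du : R -> C) : Prop :=
  [/\ L2 (cst 1) I u, L2 (cst 1) I du &
      forall phi, test_function I phi ->
        cintegral I (fun x => u x * (derive1 phi x)%:C) =
        - cintegral I (fun x => du x * (phi x)%:C)].

(* A solution is represented by the pair [U = (u, mu u')] of the representatives
   of [u] and [mu u'] that are continuous up to the boundary of [I]; the values
   of [U] outside the closure of [I] are irrelevant. *)
Definition weak_solution (I : set R) (mu rho : R -> R) (kappa : C)
    (U : R -> C * C) : Prop :=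
  exists du : R -> C,
    [/\ H1 I (fun x => (U x).1) du,
        {within closure I, continuous (fun x => (U x).1)},
        {within closure I, continuous (fun x => (U x).2)},
        (fun x => (U x).2) = (fun x => (mu x)%:C * du x) %[ae leb in I] &
        forall phi, test_function I phi ->
          cintegral I (fun x => (mu x)%:C * du x * (derive1 phi x)%:C
            - (rho x)%:C * kappa * (U x).1 * (phi x)%:C) = 0].

(* [u] is in the domain of the operator [- rho^-1 (mu u')'], and [f] is its
   image. *)
Definition sturm_liouville (mu rho : R -> R) (u f : R -> C) : Prop :=
  exists du dw : R -> C,
    [/\ H1 setT u du, H1 setT (fun x => (mu x)%:C * du x) dw &
        forall x, f x = - ((rho x)^-1)%:C * dw x].

(* [A] is the graph of an operator in L^2(R; w dx); functions equal almost
   everywhere are identified. [kappa] is in the resolvent set when [A - kappa]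
   is onto and bounded below, i.e. bijective with a bounded inverse. *)
Definition resolvent_set (w : R -> R) (A : (R -> C) -> (R -> C) -> Prop)
    : set C :=
  [set kappa |
    (forall f, L2 w setT f -> exists u g,
       A u g /\ (fun x => g x - kappa * u x) = f %[ae leb in setT]) /\
    (exists M : R, forall u g, A u g ->
       (L2norm w setT u <= M%:E * L2norm w setT (fun x => g x - kappa * u x)%R)%E)].

Definition spectrum (w : R -> R) (A : (R -> C) -> (R -> C) -> Prop) : set C :=
  ~` resolvent_set w A.

End WeakSolutions.

Section PeriodicFunctions.
Context {R : realType}.
Local Notation C := R[i].
Local Notation leb := (@lebesgue_measure R).

Definition continuous_periodic (f : R -> C) : Prop :=
  continuous f /\ forall s, f (s + 1) = f s.

Definition N_per (f : R -> C) : Prop :=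
  continuous_periodic f /\ forall s, f s != 0.

(* The winding number of [f] is [w]. *)
Definition winding_number (f : R -> C) (w : R) : Prop :=
  exists a : R -> R,
    [/\ continuous a,
        forall s, f s = (Normc.normc (f s))%:C * (cos (a s) +i* sin (a s)) &
        w = (a 1 - a 0) / (2 * pi)].

Definition L2per_norm (f : R -> C) : \bar R := L2norm (cst 1) `[0, 1] f.

Definition L2per (f : R -> C) : Prop :=
  [/\ cmeasurable setT f, forall s, f (s + 1) = f s &
      (L2per_norm f < +oo)%E].

(* Operators on [L2per] act on representatives. *)
Definition operator : Type := (R -> C) -> R -> C.

Definition opnorm (T : operator) : \bar R :=
  ereal_sup [set L2per_norm (T phi) | phi in
    [set phi | L2per phi /\ (L2per_norm phi <= 1)%E]].

Definition bounded_operator (T : operator) : Prop :=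
  [/\ forall phi, L2per phi -> L2per (T phi),
      forall phi psi, L2per phi -> L2per psi ->
        phi = psi %[ae leb in setT] -> T phi = T psi %[ae leb in setT],
      forall (a : C) phi psi, L2per phi -> L2per psi ->
        T (fun s => a * phi s + psi s) = (fun s => a * T phi s + T psi s)
          %[ae leb in setT] &
      (opnorm T < +oo)%E].

Definition op_sub (T1 T2 : operator) : operator :=
  fun phi s => T1 phi s - T2 phi s.
Definition op_add (T1 T2 : operator) : operator :=
  fun phi s => T1 phi s + T2 phi s.

Definition op_eq (T1 T2 : operator) : Prop :=
  forall phi, L2per phi -> T1 phi = T2 phi %[ae leb in setT].

Definition weighted_shift (a : R -> C) (d : R) : operator :=
  fun phi s => a (s - d) * phi (s - d).

End PeriodicFunctions.

Inductive side := left_side | right_side.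

Section RobinQuantities.
Context {R : realType}.
Local Notation C := R[i].

Definition sgn (i : side) : R := if i is right_side then 1 else - 1.

Definition half_line (i : side) : set R :=
  if i is right_side then `]0, +oo[ else `]-oo, 0[.

Definition cell (theta2 : R) (i : side) : set R :=
  if i is right_side then `]0, theta2^-1[ else `]- theta2^-1, 0[.

Definition cell_end (theta2 : R) (i : side) : R := sgn i / theta2.

(* The point value at [x] of R^i_+ and R^i_- applied to [U = (u, mu u')]:
   R^r_+- = -+ mu u' - i z u and R^l_+- = +- mu u' - i z u. *)
Definition robin_plus (z : R) (i : side) (U : R -> C * C) (x : R) : C :=
  - (sgn i)%:C * (U x).2 - (0 +i* z) * (U x).1.
Definition robin_minus (z : R) (i : side) (U : R -> C * C) (x : R) : C :=
  (sgn i)%:C * (U x).2 - (0 +i* z) * (U x).1.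

Definition fundamental_solution (z : R) (i : side) (mu rho : R -> R) (kappa : C)
    (U : R -> C * C) : Prop :=
  weak_solution (half_line i) mu rho kappa U /\ robin_plus z i U 0 = 1.

(* [b = false] and [b = true] give the cell solutions with superscripts 0 and 1. *)
Definition cell_solution (theta2 z : R) (i : side) (b : bool) (mu rho : R -> R)
    (kappa : C) (U : R -> C * C) : Prop :=
  [/\ weak_solution (cell theta2 i) mu rho kappa U,
      robin_plus z i U 0 = (~~ b)%:R &
      robin_minus z i U (cell_end theta2 i) = b%:R].

Definition eigenpair (P : @operator R) (lam : C) (phi : R -> C) : Prop :=
  [/\ `|lam| < 1, N_per phi, winding_number phi 0, phi 0 = 1 &
      forall s, P phi s = lam * phi s].

(* Q^i_s(phi, psi), with [d] the signed shift delta^i and [t0], [t1] the symbols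
   t^{i,00}, t^{i,10}. *)
Definition flux_density (t0 t1 : R -> C) (d : R) (phi psi : R -> C) (s : R) : R :=
  complex.Re (((1 - t0 s) * phi s - t1 s * psi (s + d))
      * conjc ((1 + t0 s) * phi s + t1 s * psi (s + d))).

(* The frequency is regular when there are [eps], [lam0], [phi0], [psi0] with
   this property. The flux density of the limit is independent of [s], and its
   value is taken at [s = 0]. *)
Definition regular_along (delta : R) (t00 t10 : side -> R -> C)
    (lam : side -> R -> C) (phi psi : side -> R -> R -> C)
    (eps : nat -> R) (lam0 : side -> C) (phi0 psi0 : side -> R -> C) : Prop :=
  [/\ forall j, 0 < eps j,
      eps @ \oo --> (0 : R) &
      forall i : side,
        [/\ lam i (eps j) @[j --> \oo] --> lam0 i,
            continuous_periodic (phi0 i) /\ continuous_periodic (psi0 i),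
            {uniform, phi i (eps j) @[j --> \oo] --> phi0 i},
            {uniform, psi i (eps j) @[j --> \oo] --> psi0 i} &
            flux_density (t00 i) (t10 i) (sgn i * delta) (phi0 i) (psi0 i) 0
              != 0]].

End RobinQuantities.

(* Main.v *)
Require Import Defs.
From HB Require Import structures.
From mathcomp Require Import all_boot all_order all_algebra.
From mathcomp Require Import complex.
From mathcomp Require Import all_classical all_reals all_analysis.
From mathcomp Require Import measurable_realfun ring lra.
Set Implicit Arguments.
Unset Strict Implicit.
Unset Printing Implicit Defensive.
Import Order.TTheory GRing.Theory Num.Theory numFieldNormedType.Exports.
Local Open Scope classical_set_scope.
Local Open Scope ring_scope.
Local Open Scope complex_scope.

(** Fix [s] and let [v] be the multiple [phi(s) u_s] of the fundamental solution
    with absorption [eps], restricted to one cell [[0, L]], [L = 1 / theta2].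
    Its incoming Robin data at the two ends are [phi(s)] and [psi(s + delta)],
    and the eigenvalue equation says that its outgoing datum at [L] is
    [lambda phi(s + delta)].  Moreover [x |-> u_s(x + L)] solves the equation
    whose coefficients belong to [s + delta]; on a half-line with absorption the
    square-integrable solutions form a line ([robin_minus_proportional]), hence
    [psi(s)] is [lambda] times the outgoing datum of [v] at [0].

    Letting [eps] tend to [0] in these relations needs no compactness of the
    solutions.  Pair [v] with a cell solution [e] without absorption: their
    Wronskian has derivative [- i eps rho v e], and its end values are bilinear
    in the Robin data.  The energy balance bounds [eps] times the integral of
    [rho |v|^2] by the Robin data of [v], so the increment of the Wronskian is of
    order [sqrt eps] ([wronskian_increment]).  In the limit the outgoing data of
    [v] are therefore given by the cell coefficients without absorption
    ([cell_vanishing_absorption]), and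
    - [lambda0 phi0(s + delta) = t01(s) phi0(s) + t11(s) psi0(s + delta)],
    - [psi0(s) = lambda0 (t00(s) phi0(s) + t10(s) psi0(s + delta))].
    Once [phi0] is known not to vanish, dividing by [phi0] turns the first line
    into the first Riccati equation and the second line into the second one.

    That [phi0] has no zero comes from the energy flux [Q(s)], the difference
    of the squared moduli of the incoming and outgoing data at [0].  It is
    nonnegative because it is so for [eps > 0], it satisfies
    [Q(s) = |lambda0|^2 Q(s + delta)] because the flux is constant along a cell
    without absorption, and [|lambda0| <= 1].  Hence
    [|phi0(n delta)|^2 >= Q(n delta) >= Q(0) > 0] for all natural [n], and since
    the multiples of the irrational [delta] are dense modulo [1], [|phi0|] is
    bounded below everywhere ([nonvanishing_limit]).

    The symbols with absorption are the quotients
    [lambda phi(s + delta) / phi(s)] and [psi(s + delta) / phi(s)], which then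
    converge uniformly, and the norm of a weighted shift is at most the supremum
    of its weight. *)

(** * Primitives of continuous functions *)

Section DuBoisReymond.
Context {R : realType}.
Local Notation leb := (@lebesgue_measure R).
Implicit Types (f g : R -> R) (c d x : R).

Lemma is_derive1_cst (k x : R) : is_derive x 1 (fun=> k) 0.
Proof. exact: is_derive_cst. Qed.

Lemma is_derive1D f g x (a b : R) : is_derive x 1 f a -> is_derive x 1 g b ->
  is_derive x 1 (fun y => f y + g y) (a + b).
Proof. by move=> df dg; exact: is_deriveD. Qed.

Lemma is_derive1B f g x (a b : R) : is_derive x 1 f a -> is_derive x 1 g b ->
  is_derive x 1 (fun y => f y - g y) (a - b).
Proof. by move=> df dg; exact: is_deriveB. Qed.

Lemma is_derive1M f g x (a b : R) : is_derive x 1 f a -> is_derive x 1 g b ->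
  is_derive x 1 (fun y => f y * g y) (a * g x + f x * b).
Proof.
move=> df dg; apply: is_derive_eq (is_deriveM df dg) _.
by rewrite /GRing.scale/= addrC [g x * a]mulrC.
Qed.

Lemma is_derive1Z (k : R) f x (a : R) : is_derive x 1 f a ->
  is_derive x 1 (fun y => k * f y) (k * a).
Proof.
move=> df; apply: is_derive_eq (is_derive1M (is_derive1_cst k x) df) _.
by rewrite mul0r add0r.
Qed.

Lemma is_derive1_continuous f x (a : R) : is_derive x 1 f a -> {for x, continuous f}.
Proof.
by case=> df _; apply: differentiable_continuous; apply/derivable1_diffP.
Qed.

Lemma is_derive1_0_cst f c d : c <= d -> (forall x, c <= x <= d -> is_derive x 1 f 0) ->
  f c = f d.
Proof.
move=> cd df; have [|||x _] := @MVT_segment R f (fun=> 0) c d => //.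
- by move=> x; rewrite in_itv/= => /andP[cx xd]; apply: df; rewrite !ltW.
- apply/continuous_in_subspaceT => x; rewrite inE/= in_itv/= => xcd.
  exact: is_derive1_continuous (df _ xcd).
- by rewrite mul0r => /eqP; rewrite subr_eq0 => /eqP.
Qed.

Lemma primitive_exists (f : R -> R) (a : R) : continuous f ->
  exists F, forall x, a < x -> is_derive x 1 F (f x).
Proof.
move=> cf; exists (fun x => \int[leb]_(t in `[a, x]) f t) => x ax.
have intf : leb.-integrable `[a, x + 1] (EFin \o f).
  apply: continuous_compact_integrable; first exact: segment_compact.
  exact: continuous_subspaceT.
have xx1 : x < x + 1 by rewrite ltrDl.
have [dF F'] := continuous_FTC1_closed xx1 intf ax (cf x).
by rewrite derive1E in F'; exact: DeriveDef.
Qed.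

Lemma Rintegral_primitive (F f : R -> R) (c d : R) : c < d -> continuous f ->
  (forall x, c <= x -> is_derive x 1 F (f x)) ->
  \int[leb]_(x in `[c, d]) f x = F d - F c.
Proof.
move=> cd cf dF; rewrite /Rintegral (@continuous_FTC2 _ _ F)//.
- exact: continuous_subspaceT.
- have cF x : c <= x -> {for x, continuous F} by move=> /dF/is_derive1_continuous.
  split.
  + by move=> x; rewrite in_itv/= => /andP[/ltW/dF[]].
  + exact/cvg_at_right_filter/cF.
  + exact/cvg_at_left_filter/cF/ltW.
- move=> x; rewrite in_itv/= => /andP[/ltW/dF[dFx Fx] _].
  by rewrite derive1E.
Qed.

(** * The lemma of du Bois-Reymond *)

Definition clamp (c d x : R) := Num.max c (Num.min x d).

Lemma clamp_continuous c d : continuous (clamp c d).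
Proof.
move=> x; apply: (@continuous_comp _ _ _ (fun x => Num.min x d) (Num.max c)).
  by apply: continuous_min => //; exact: cvg_cst.
by apply: continuous_max => //; exact: cvg_cst.
Qed.

Lemma clamp_in c d x : c <= d -> c <= clamp c d x <= d.
Proof. by move=> cd; rewrite /clamp le_max lexx ge_max cd ge_min lexx orbT. Qed.

Lemma clamp_id c d x : c <= x <= d -> clamp c d x = x.
Proof. by move=> /andP[cx xd]; rewrite /clamp (min_idPl xd) (max_idPr cx). Qed.

Lemma clamp_comp_continuous f c d : c <= d ->
  {in `[c, d], continuous f} -> continuous (f \o clamp c d).
Proof.
move=> cd cf x; apply: continuous_comp; first exact: clamp_continuous.
by apply: cf; rewrite in_itv/= clamp_in.
Qed.

(** The test function is a primitive of [(h - m) b], where [h] is [f] minus a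
    primitive [G] of [g], [b] is a bump supported in [[c, d]] and [m] is the
    [b]-average of [h]; subtracting [m] is what gives the primitive compact
    support.  The weak equation then reads: the integral of [(h - m)^2 b]
    vanishes, so [f - G] is constant on the segment. *)
Lemma du_bois_reymond (I : set R) f g c d : measurable I -> c < d ->
  `[c, d] `<=` I -> {in `[c, d], continuous f} -> {in `[c, d], continuous g} ->
  (forall phi, test_function I phi ->
    \int[leb]_(x in I) (f x * derive1 phi x + g x * phi x) = 0) ->
  forall x, c < x < d -> is_derive x 1 f (g x).
Proof.
move=> mI cd cdI cf cg weak.
(* Outside [[c, d]] nothing is known about [f] and [g]; composing with the
   clamp makes them continuous everywhere without changing them inside. *)
pose f1 := f \o clamp c d; pose g1 := g \o clamp c d.
have cf1 : continuous f1 by apply: clamp_comp_continuous => //; exact: ltW.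
have cg1 : continuous g1 by apply: clamp_comp_continuous => //; exact: ltW.
have [G dG] := primitive_exists (c - 1) cg1.
pose h x := f1 x - (G \o clamp c d) x.
have ch : continuous h.
  move=> x; apply: cvgB; first exact: cf1.
  apply: clamp_comp_continuous; first exact: ltW.
  move=> y; rewrite in_itv/= => /andP[cy _].
  by apply: is_derive1_continuous; apply: dG; lra.
pose b x := Num.max 0 ((x - c) * (d - x)).
have cb : continuous b.
  move=> x; apply: (@continuous_comp _ _ _ (fun x => (x - c) * (d - x)) (Num.max 0)).
    apply: cvgM; first by apply: cvgB => //; exact: cvg_cst.
    by apply: cvgB => //; exact: cvg_cst.
  by apply: continuous_max => //; exact: cvg_cst.
have b_ge0 x : 0 <= b x by rewrite /b le_max lexx.
have b_gt0 x : c < x < d -> 0 < b x.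
  by move=> xcd; rewrite /b lt_max; apply/orP; right; apply: mulr_gt0; lra.
have b_out x : (x <= c) || (d <= x) -> b x = 0.
  move=> xcd; apply/max_idPl; case/orP: xcd => ?.
    by apply: mulr_le0_ge0; lra.
  by apply: mulr_ge0_le0; lra.
have [A dA] : exists A, forall x, c - 1 < x -> is_derive x 1 A (h x * b x).
  by apply: primitive_exists => x; apply: cvgM; [exact: ch|exact: cb].
have [B dB] := primitive_exists (c - 1) cb.
have Bcd : 0 < B d - B c.
  have [||x xcd ->] := @MVT R B b c d cd.
  - by move=> x; rewrite in_itv/= => /andP[cx _]; apply: dB; lra.
  - apply/continuous_in_subspaceT => x; rewrite inE/= in_itv/= => /andP[cx _].
    by apply: is_derive1_continuous; apply: dB; lra.
  - by apply: mulr_gt0; [apply: b_gt0; move: xcd; rewrite in_itv|lra].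
pose m := (A d - A c) / (B d - B c).
pose k x := (h x - m) * b x.
have ck : continuous k.
  move=> x; apply: cvgM; last exact: cb.
  by apply: cvgB; [exact: ch|exact: cvg_cst].
pose phi0 x := A x - A c - m * (B x - B c).
have dphi0 x : c - 1 < x -> is_derive x 1 phi0 (k x).
  move=> cx; have dA1 := is_derive1B (dA x cx) (is_derive1_cst (A c) x).
  have dB1 := is_derive1Z m (is_derive1B (dB x cx) (is_derive1_cst (B c) x)).
  by apply: is_derive_eq (is_derive1B dA1 dB1) _; rewrite /k; ring.
have k_out x : (x <= c) || (d <= x) -> k x = 0.
  by move=> /b_out bx; rewrite /k bx mulr0.
have phi0_l x : c - 1 < x <= c -> phi0 x = 0.
  move=> /andP[cx xc]; have -> : phi0 x = phi0 c; last by rewrite /phi0 !subrr; ring.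
  apply: is_derive1_0_cst => // y xy; rewrite -(k_out y); first by apply: dphi0; lra.
  by apply/orP; left; lra.
have phi0_r x : d <= x -> phi0 x = 0.
  move=> dx; have <- : phi0 d = phi0 x.
    apply: is_derive1_0_cst => // y xy; rewrite -(k_out y); first by apply: dphi0; lra.
    by apply/orP; right; lra.
  by rewrite /phi0 /m divfK ?subrr// gt_eqF.
(* [primitive_exists] only describes [phi0] to the right of [c - 1]; cutting
   it at [c], where it already vanishes, gives a global test function. *)
pose phi x := if x < c then 0 else phi0 x.
have phi_eq x : c - 1 < x -> phi x = phi0 x.
  by move=> cx; rewrite /phi; case: ltP => // xc; rewrite phi0_l//; lra.
have dphi x : is_derive x 1 phi (k x).
  have [xc|cx] := ltP x c.
    apply: (@near_eq_is_derive _ _ _ (cst 0)) => //.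
      near=> y; rewrite /phi ifT//.
      by near: y; exact: lt_nbhsl.
    by rewrite (k_out x); [exact: is_derive_cst|rewrite (ltW xc)].
  apply: (@near_eq_is_derive _ _ _ phi0) => //; last by apply: dphi0; lra.
  near=> y; rewrite phi_eq//.
  by near: y; apply: lt_nbhsr; lra.
have dphiE : derive1 phi = k.
  by apply/funext => x; rewrite derive1E; case: (dphi x).
have phi_out x : x \notin `[c, d] -> phi x = 0.
  rewrite in_itv/= negb_and -!ltNge /phi => /orP[->//|dx].
  by case: ltP => // _; rewrite phi0_r// ltW.
have tphi : test_function I phi.
  split; first by move=> x; case: (dphi x).
    by rewrite dphiE.
  by exists c, d.
have := weak _ tphi; rewrite dphiE.
have cphi : continuous phi by move=> x; exact: is_derive1_continuous (dphi x).
pose l x := f1 x * k x + g1 x * phi x.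
have cl : continuous l.
  by move=> x; apply: cvgD; apply: cvgM; [exact: cf1|exact: ck|exact: cg1|exact: cphi].
have -> : \int[leb]_(x in I) (f x * k x + g x * phi x) =
    \int[leb]_(x in `[c, d]) l x.
  rewrite Rintegral_mkcond [RHS]Rintegral_mkcond.
  congr Rintegral; apply/funext => x; rewrite !patchE.
  have [xcd|xcd] := boolP (x \in `[c, d]).
    rewrite !ifT ?inE//; last exact: cdI.
    by rewrite /l /f1 /g1/= clamp_id.
  rewrite [in RHS]ifF; last by apply/negbTE; move: xcd; rewrite notin_setE => /negP.
  case: ifPn => // _; rewrite phi_out// k_out ?mulr0 ?addr0//.
  by move: xcd; rewrite in_itv/= negb_and -!ltNge => /orP[/ltW->//|/ltW->]; rewrite orbT.
have [K dK] := primitive_exists (c - 1) cl.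
have -> : \int[leb]_(x in `[c, d]) l x = K d - K c.
  by apply: Rintegral_primitive => // x cx; apply: dK; lra.
move=> Kcd.
(* [N] is a primitive of [(h - m)^2 b]: the terms in [phi] integrate by parts
   [g phi + G phi'] and discard the multiple [m phi']. *)
pose N x := K x - G x * phi x - m * phi x.
pose n x := (h x - m) ^+ 2 * b x.
have dN x : c <= x <= d -> is_derive x 1 N (n x).
  move=> xcd; have cx : c - 1 < x by lra.
  have := is_derive1B (is_derive1B (dK x cx) (is_derive1M (dG x cx) (dphi x))) (is_derive1Z m (dphi x)).
  move=> /is_derive_eq; apply; rewrite /l /n /k /h /f1 /g1/= clamp_id//; ring.
have N_mono x y : c <= x -> x <= y -> y <= d -> N x <= N y.
  move=> cx xy yd; rewrite -subr_ge0.
  have [|||t txy ->] := @MVT_segment R N n x y => //.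
  - by move=> t; rewrite in_itv/= => /andP[xt ty]; apply: dN; lra.
  - apply/continuous_in_subspaceT => t; rewrite inE/= in_itv/= => /andP[xt ty].
    by apply: is_derive1_continuous; apply: dN; lra.
  - by apply: mulr_ge0; [rewrite mulr_ge0 ?sqr_ge0|lra].
have Ncd : N c = N d.
  rewrite /N !phi_eq; [|lra|lra].
  rewrite (phi0_l c); last lra.
  by rewrite (phi0_r d)// !mulr0 !subr0; lra.
have N_cst x : c <= x <= d -> N x = N c.
  move=> /andP[cx xd]; apply/le_anti/andP; split; last exact: N_mono.
  by rewrite Ncd; exact: N_mono.
have n0 x : c < x < d -> n x = 0.
  move=> xcd; have [_ <-] := dN x ltac:(lra).
  have : is_derive x 1 N 0.
    apply: (near_eq_is_derive _ (is_derive_cst (N c) x 1)).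
    near=> y; apply/esym/N_cst; apply/andP; split; apply: ltW.
      by near: y; apply: lt_nbhsr; lra.
    by near: y; apply: lt_nbhsl; lra.
  by case.
have hm x : c < x < d -> h x = m.
  move=> xcd; have /eqP := n0 x xcd.
  by rewrite /n mulf_eq0 (gt_eqF (b_gt0 _ xcd)) orbF sqrf_eq0 subr_eq0 => /eqP.
move=> x xcd.
apply: (@near_eq_is_derive _ _ _ (fun y => G y + m)).
  near=> y.
  have ycd : c < y < d.
    apply/andP; split; near: y; [apply: lt_nbhsr|apply: lt_nbhsl]; lra.
  have := hm y ycd; rewrite /h /f1/= clamp_id; last lra.
  by move=> <-; ring.
have := is_derive1D (dG x ltac:(lra)) (is_derive1_cst m x).
by move=> /is_derive_eq; apply; rewrite addr0 /g1/= clamp_id//; lra.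
Unshelve. all: by end_near. Qed.

End DuBoisReymond.

(** * Complex-valued functions of a real variable *)

Section ComplexTopology.
Context {R : realType}.
Local Notation C := R[i].
Local Notation normc := Normc.normc.

Lemma normr_normc (x : C) : `|x| = (normc x)%:C.
Proof. by case: x. Qed.

Lemma complex_ReIm (x : C) : x = complex.Re x +i* complex.Im x.
Proof. by case: x. Qed.

Lemma normc_sqr (x : C) : normc x ^+ 2 = complex.Re x ^+ 2 + complex.Im x ^+ 2.
Proof. by case: x => a b /=; rewrite sqr_sqrtr// addr_ge0// sqr_ge0. Qed.

Lemma normc_ge0 (x : C) : 0 <= normc x.
Proof. by case: x => a b /=; rewrite sqrtr_ge0. Qed.

Lemma Re_le_normc (x : C) : `|complex.Re x| <= normc x.
Proof.
rewrite -ler_sqr ?nnegrE ?normc_ge0// normc_sqr real_normK ?num_real//.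
by rewrite lerDl sqr_ge0.
Qed.

Lemma Im_le_normc (x : C) : `|complex.Im x| <= normc x.
Proof.
rewrite -ler_sqr ?nnegrE ?normc_ge0// normc_sqr real_normK ?num_real//.
by rewrite lerDr sqr_ge0.
Qed.

Lemma cReB (x y : C) : complex.Re (x - y) = complex.Re x - complex.Re y.
Proof. by case: x; case: y. Qed.

Lemma cImB (x y : C) : complex.Im (x - y) = complex.Im x - complex.Im y.
Proof. by case: x; case: y. Qed.

Lemma cReD (x y : C) : complex.Re (x + y) = complex.Re x + complex.Re y.
Proof. by case: x; case: y. Qed.

Lemma cImD (x y : C) : complex.Im (x + y) = complex.Im x + complex.Im y.
Proof. by case: x; case: y. Qed.

Lemma cReM (x y : C) : complex.Re (x * y) =
  complex.Re x * complex.Re y - complex.Im x * complex.Im y.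
Proof. by case: x; case: y. Qed.

Lemma cImM (x y : C) : complex.Im (x * y) =
  complex.Re x * complex.Im y + complex.Im x * complex.Re y.
Proof. by case: x; case: y. Qed.

Lemma cReJ (x : C) : complex.Re (conjc x) = complex.Re x.
Proof. by case: x. Qed.

Lemma cImJ (x : C) : complex.Im (conjc x) = - complex.Im x.
Proof. by case: x. Qed.

Lemma normcB (x y : C) : normc (x - y) = normc (y - x).
Proof. by rewrite -opprB normcN. Qed.

(** The topology of [R[i]] measures distances by elements of [R[i]]; the
    estimates below use the real-valued modulus. *)
Lemma normc_cvgP (T : Type) (F : set_system T) {FF : Filter F} (f : T -> C) l :
  f x @[x --> F] --> l <-> forall e : R, 0 < e -> \forall x \near F, normc (f x - l) < e.
Proof.
split=> [fl e e0|fl].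
  have ec : 0 < e%:C by rewrite ltcR.
  have /cvgrPdist_lt/(_ _ ec) := fl.
  by apply: filterS => x; rewrite normr_normc normcB ltcR.
apply/cvgrPdist_lt => -[e e'] /= /[dup] H.
rewrite ltcE/= => /andP[/eqP e'0 e0]; move: (fl e e0); apply: filterS => x.
by rewrite normr_normc normcB e'0 ltcR.
Qed.

Lemma Re_continuous : continuous (@complex.Re R : C -> R).
Proof.
move=> x; apply/(@cvgrPdist_lt _ _ _ (nbhs x) (nbhs_filter x)) => e e0.
have := (@normc_cvgP _ (nbhs x) (nbhs_filter x) id x).1 (@cvg_id _ _) e e0.
apply: filterS => y; rewrite normcB; apply: le_lt_trans.
by rewrite -cReB; exact: Re_le_normc.
Qed.

Lemma Im_continuous : continuous (@complex.Im R : C -> R).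
Proof.
move=> x; apply/(@cvgrPdist_lt _ _ _ (nbhs x) (nbhs_filter x)) => e e0.
have := (@normc_cvgP _ (nbhs x) (nbhs_filter x) id x).1 (@cvg_id _ _) e e0.
apply: filterS => y; rewrite normcB; apply: le_lt_trans.
by rewrite -cImB; exact: Im_le_normc.
Qed.

Lemma normc_le_ReIm (x : C) : normc x <= `|complex.Re x| + `|complex.Im x|.
Proof.
rewrite -ler_sqr ?nnegrE ?addr_ge0 ?normc_ge0// normc_sqr sqrrD !real_normK ?num_real//.
by rewrite lerD2r lerDl mulrn_wge0// mulr_ge0.
Qed.

Lemma measurable_normc_sqr (D : set R) (f : R -> C) : cmeasurable D f ->
  measurable_fun D (fun x => normc (f x) ^+ 2).
Proof.
move=> [mr mi]; rewrite (_ : (fun x => normc (f x) ^+ 2) =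
    (fun x => complex.Re (f x) ^+ 2 + complex.Im (f x) ^+ 2)).
  by apply: measurable_funD; exact: measurable_funX.
by apply/funext => x; rewrite normc_sqr.
Qed.

End ComplexTopology.

Section Derivatives.
Context {R : realType}.
Local Notation C := R[i].
Local Notation normc := Normc.normc.
Local Notation Re := (@complex.Re R).
Local Notation Im := (@complex.Im R).
Implicit Types (f g : R -> C) (x : R) (a b : C).

(** Componentwise, so that the mean value theorem applies to each part. *)
Definition cderiv f x a :=
  is_derive x 1 (Re \o f) (Re a) /\ is_derive x 1 (Im \o f) (Im a).

Lemma is_derive_ext (h k : R -> R) x (l m : R) :
  is_derive x 1 h l -> h =1 k -> l = m -> is_derive x 1 k m.
Proof. by move=> + /funext <- <-. Qed.

Lemma cderiv_eq f x a b : cderiv f x a -> a = b -> cderiv f x b.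
Proof. by move=> ? <-. Qed.

Lemma cderiv_cst a x : cderiv (fun=> a) x 0.
Proof. by split; exact: is_derive1_cst. Qed.

Lemma cderivD f g x a b : cderiv f x a -> cderiv g x b ->
  cderiv (fun y => f y + g y) x (a + b).
Proof.
move=> [fr fi] [gr gi]; split.
- by apply: (is_derive_ext (is_derive1D fr gr)) => [y|]; rewrite ?cReD//= cReD.
- by apply: (is_derive_ext (is_derive1D fi gi)) => [y|]; rewrite ?cImD//= cImD.
Qed.

Lemma cderivB f g x a b : cderiv f x a -> cderiv g x b ->
  cderiv (fun y => f y - g y) x (a - b).
Proof.
move=> [fr fi] [gr gi]; split.
- by apply: (is_derive_ext (is_derive1B fr gr)) => [y|]; rewrite ?cReB//= cReB.
- by apply: (is_derive_ext (is_derive1B fi gi)) => [y|]; rewrite ?cImB//= cImB.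
Qed.

Lemma cderivM f g x a b : cderiv f x a -> cderiv g x b ->
  cderiv (fun y => f y * g y) x (a * g x + f x * b).
Proof.
move=> [fr fi] [gr gi]; split.
- apply: (is_derive_ext (is_derive1B (is_derive1M fr gr) (is_derive1M fi gi))) => [y|].
    by rewrite /= cReM.
  by rewrite /= cReD !cReM; ring.
- apply: (is_derive_ext (is_derive1D (is_derive1M fr gi) (is_derive1M fi gr))) => [y|].
    by rewrite /= cImM.
  by rewrite /= cImD !cImM; ring.
Qed.

Lemma cderivJ f x a : cderiv f x a -> cderiv (fun y => conjc (f y)) x (conjc a).
Proof.
move=> [fr fi]; split.
- by apply: (is_derive_ext fr) => [y|]; rewrite /= cReJ.
- by apply: (is_derive_ext (is_derive1Z (-1) fi)) => [y|]; rewrite /= cImJ mulN1r.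
Qed.

Definition ccont (A : set R) f :=
  {within A, continuous (Re \o f)} /\ {within A, continuous (Im \o f)}.

Lemma within_continuous_ext (A : set R) (h k : R -> R) : h =1 k ->
  {within A, continuous h} -> {within A, continuous k}.
Proof. by move=> /funext ->. Qed.

Lemma ccont_cst (A : set R) a : ccont A (fun=> a).
Proof. by split; move=> x; exact: cvg_cst. Qed.

Lemma ccontD A f g : ccont A f -> ccont A g -> ccont A (fun y => f y + g y).
Proof.
move=> [fr fi] [gr gi]; split.
- apply: (@within_continuous_ext _ (fun y => Re (f y) + Re (g y))).
    by move=> y /=; case: (f y); case: (g y).
  by move=> x; apply: cvgD; [exact: fr|exact: gr].
- apply: (@within_continuous_ext _ (fun y => Im (f y) + Im (g y))).
    by move=> y /=; case: (f y); case: (g y).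
  by move=> x; apply: cvgD; [exact: fi|exact: gi].
Qed.

Lemma ccontM A f g : ccont A f -> ccont A g -> ccont A (fun y => f y * g y).
Proof.
move=> [fr fi] [gr gi]; split.
- apply: (@within_continuous_ext _
    (fun y => Re (f y) * Re (g y) - Im (f y) * Im (g y))).
    by move=> y /=; case: (f y); case: (g y).
  move=> x; apply: cvgB; apply: cvgM;
    [exact: fr|exact: gr|exact: fi|exact: gi].
- apply: (@within_continuous_ext _
    (fun y => Re (f y) * Im (g y) + Im (f y) * Re (g y))).
    by move=> y /=; case: (f y) => ? ?; case: (g y) => ?? /=; ring.
  move=> x; apply: cvgD; apply: cvgM;
    [exact: fr|exact: gi|exact: fi|exact: gr].
Qed.

Lemma ccontJ A f : ccont A f -> ccont A (fun y => conjc (f y)).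
Proof.
move=> [fr fi]; split.
- by apply: (within_continuous_ext _ fr) => y /=; case: (f y).
- apply: (@within_continuous_ext _ (fun y => - Im (f y))).
    by move=> y /=; case: (f y).
  by move=> x; apply: cvgN; exact: fi.
Qed.

Lemma ccont_continuous (A : set R) f : {within A, continuous f} -> ccont A f.
Proof.
move=> cf; split => x.
- apply: (@continuous_comp (subspace A) C R f Re x); first exact: cf.
  exact: Re_continuous.
- apply: (@continuous_comp (subspace A) C R f Im x); first exact: cf.
  exact: Im_continuous.
Qed.

Lemma ccontS (A B : set R) f : A `<=` B -> ccont B f -> ccont A f.
Proof. by move=> AB [? ?]; split; exact: continuous_subspaceW AB _. Qed.

End Derivatives.

Section WeakToClassical.
Context {R : realType}.
Local Notation leb := (@lebesgue_measure R).
Implicit Types (f g h : R -> R) (I : set R).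

Lemma ae_imp (P Q : R -> Prop) : (forall x, P x -> Q x) ->
  {ae leb, forall x, P x} -> {ae leb, forall x, Q x}.
Proof.
move=> PQ [N [mN N0 sN]]; exists N; split => // x nQ; apply: sN => /= Px.
exact/nQ/PQ.
Qed.

Lemma compact_support_integrable I f (c d : R) : measurable I ->
  `[c, d] `<=` I -> {within `[c, d], continuous f} ->
  (forall x, x \notin `[c, d] -> f x = 0) -> leb.-integrable I (EFin \o f).
Proof.
move=> mI cdI cf f0.
have H : leb.-integrable `[c, d] (EFin \o f).
  apply: continuous_compact_integrable => //; exact: segment_compact.
rewrite integrable_mkcond//.
have -> : (EFin \o f) \_ I = (EFin \o f) \_ `[c, d].
  apply/funext => x /=; rewrite !patchE.
  have [xcd|xcd] := boolP (x \in `[c, d]%classic).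
    by rewrite ifT//; rewrite inE; apply: cdI; move: xcd; rewrite inE.
  by case: ifPn => // _; rewrite /= f0//; move: xcd; rewrite notin_setE => /negP.
by rewrite -integrable_mkcond.
Qed.

Lemma test_function_derive_out (phi : R -> R) (c d : R) :
  (forall x, x \notin `[c, d] -> phi x = 0) ->
  forall x, x \notin `[c, d] -> derive1 phi x = 0.
Proof.
move=> phi0 x xcd; rewrite derive1E.
have : is_derive x 1 phi 0.
  apply: (near_eq_is_derive _ (is_derive_cst (0 : R) x 1)).
  move: xcd => /negP xcd.
  have : open_nbhs x (~` `[c, d]%classic : set R).
    by split => //; apply: closed_openC; exact: interval_closed.
  move=> /open_nbhs_nbhs; apply: filterS => y /= ycd.
  by rewrite phi0//; exact/negP.
by case.
Qed.

Lemma open_segment I x : open I -> I x -> exists c d, c < x < d /\ `[c, d] `<=` I.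
Proof.
move=> oI Ix; have /nbhs_ballP[e /= e0 eI] := open_nbhs_nbhs (conj oI Ix).
exists (x - e / 2), (x + e / 2); split; first by lra.
move=> y /=; rewrite in_itv/= => ye; apply: eI; rewrite /ball/= ltr_norml.
by lra.
Qed.

(** A flux that is only known almost everywhere may be replaced by its
    continuous representative in the weak equation. *)
Lemma weak_equation_derive I f g h : open I ->
  {in I, continuous f} -> {in I, continuous g} -> measurable_fun I h ->
  h = f %[ae leb in I] ->
  (forall phi, test_function I phi ->
    \int[leb]_(x in I) (h x * derive1 phi x + g x * phi x) = 0) ->
  forall x, I x -> is_derive x 1 f (g x).
Proof.
move=> oI cf cg mh hf weak x Ix.
have mI : measurable I := open_measurable oI.
have mf : measurable_fun I f by exact: open_continuous_measurable_fun.
have mg : measurable_fun I g by exact: open_continuous_measurable_fun.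
have [c [d [xcd cdI]]] := open_segment oI Ix.
apply: (@du_bois_reymond _ I f g c d) => //; first lra.
- by move=> y ycd; apply: cf; rewrite inE; apply: cdI.
- by move=> y ycd; apply: cg; rewrite inE; apply: cdI.
move=> phi tphi; rewrite -[RHS](weak _ tphi); congr fine.
have [dphi cphi' _] := tphi.
have mphi : measurable_fun I phi.
  apply: measurable_funTS; apply: continuous_measurable_fun => y.
  by apply: differentiable_continuous; apply/derivable1_diffP.
have mphi' : measurable_fun I (derive1 phi).
  by apply: measurable_funTS; exact: continuous_measurable_fun.
apply: ae_eq_integral => //.
- apply/measurable_EFinP; apply: measurable_funD; exact: measurable_funM.
- apply/measurable_EFinP; apply: measurable_funD; exact: measurable_funM.
- by apply: (ae_imp _ hf) => y H Iy; rewrite H.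
Qed.

(** The definition of the weak derivative has one integral on each side;
    compact support makes both integrands integrable, so that they can be added
    to give the hypothesis of [weak_equation_derive]. *)
Lemma weak_derivative_derive I f g h : open I ->
  {in I, continuous f} -> {in I, continuous g} -> measurable_fun I h ->
  h = g %[ae leb in I] ->
  (forall phi, test_function I phi ->
    \int[leb]_(x in I) (f x * derive1 phi x) = - \int[leb]_(x in I) (h x * phi x)) ->
  forall x, I x -> is_derive x 1 f (g x).
Proof.
move=> oI cf cg mh hg weak.
have mI : measurable I := open_measurable oI.
have mf : measurable_fun I f by exact: open_continuous_measurable_fun.
have mg : measurable_fun I g by exact: open_continuous_measurable_fun.
apply: (weak_equation_derive oI cf cg mf); first exact: ae_eq_refl.
move=> phi tphi; have := weak _ tphi.
have [dphi cphi' [c [d [cdI phi0]]]] := tphi.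
have cphi : continuous phi.
  by move=> y; apply: differentiable_continuous; apply/derivable1_diffP.
have mphi : measurable_fun I phi.
  by apply: measurable_funTS; exact: continuous_measurable_fun.
have -> : \int[leb]_(x in I) (h x * phi x) = \int[leb]_(x in I) (g x * phi x).
  congr fine; apply: ae_eq_integral => //.
  - by apply/measurable_EFinP; exact: measurable_funM.
  - by apply/measurable_EFinP; exact: measurable_funM.
  - by apply: (ae_imp _ hg) => y H Iy; rewrite H.
move=> E; rewrite RintegralD//; first by rewrite E addNr.
- apply: (@compact_support_integrable _ _ c d) => //.
    apply/continuous_in_subspaceT => y; rewrite inE => ycd; apply: cvgM.
      by apply: cf; rewrite inE; exact: cdI.
    exact: cphi'.
  by move=> y ycd; rewrite (test_function_derive_out phi0 ycd) mulr0.
- apply: (@compact_support_integrable _ _ c d) => //.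
    apply/continuous_in_subspaceT => y; rewrite inE => ycd; apply: cvgM.
      by apply: cg; rewrite inE; exact: cdI.
    exact: cphi.
  by move=> y ycd; rewrite phi0 ?mulr0.
Qed.

(** Regularity bootstrap: [u] and [mu u'] have continuous representatives, so
    the two weak identities are between continuous functions and hence
    classical. *)
Lemma weak_solution_ode I (mu rho : R -> R) (kappa : R[i]) (U : R -> R[i] * R[i]) :
  open I -> continuous mu -> (forall x, 0 < mu x) -> continuous rho ->
  weak_solution I mu rho kappa U -> forall x, I x ->
  cderiv (fun y => (U y).1) x ((mu x)^-1%:C * (U x).2) /\
  cderiv (fun y => (U y).2) x (- (rho x)%:C * kappa * (U x).1).
Proof.
move=> oI cmu mu0 crho [du [[_ [mdu _] wdu] cu cw wE weak]].
have [cur cui] := ccont_continuous cu; have [cwr cwi] := ccont_continuous cw.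
have {cu cw} inI f : {within closure I, continuous f} -> {in I, continuous f}.
  move=> /(continuous_subspaceW (@subset_closure _ I)).
  by rewrite continuous_open_subspace.
have mmu : measurable_fun I mu.
  by apply: measurable_funTS; exact: continuous_measurable_fun.
(* The argument is real; it is applied to the real and to the imaginary part. *)
have part (T : R[i] -> R) :
    (forall a b, T (a - b) = T a - T b) -> (forall a, T (- a) = - T a) ->
    (forall a (r : R), T (a * r%:C) = T a * r) ->
    (forall F, T (cintegral I F) = \int[leb]_(x in I) T (F x)) ->
    measurable_fun I (fun x => T (du x)) ->
    {within closure I, continuous (fun x => T (U x).1)} ->
    {within closure I, continuous (fun x => T (U x).2)} ->
    {in I, continuous (fun x => T (kappa * (U x).1))} ->
    forall x, I x -> is_derive x 1 (fun y => T (U y).1) (T ((mu x)^-1%:C * (U x).2)) /\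
      is_derive x 1 (fun y => T (U y).2) (T (- (rho x)%:C * kappa * (U x).1)).
  move=> TB TN TZ Tint mTdu /inI cTu /inI cTw cTk.
  have TZl a (r : R) : T (r%:C * a) = r * T a by rewrite mulrC TZ mulrC.
  have E1 : (fun x => T ((mu x)^-1%:C * (U x).2)) = (fun x => (mu x)^-1 * T (U x).2).
    by apply/funext => y; rewrite TZl.
  have E2 : (fun x => T (- (rho x)%:C * kappa * (U x).1)) =
      (fun x => - (rho x * T (kappa * (U x).1))).
    by apply/funext => y; rewrite -mulrA mulNr TN TZl.
  move=> x Ix; split.
    apply: (@weak_derivative_derive I (fun y => T (U y).1)
      (fun y => T ((mu y)^-1%:C * (U y).2)) (fun y => T (du y))) => //.
    - rewrite E1 => y Iy; apply: cvgM; last exact: cTw.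
      by apply: cvgV; [rewrite gt_eqF|exact: cmu].
    - apply: (ae_imp _ wE) => y H Iy.
      by rewrite (H Iy) !TZl mulKf// gt_eqF.
    - move=> phi tphi; have := congr1 T (wdu phi tphi).
      rewrite TN !Tint.
      under eq_Rintegral do rewrite TZ.
      by under [X in _ = - X]eq_Rintegral do rewrite TZ.
  apply: (@weak_equation_derive I (fun y => T (U y).2)
    (fun y => T (- (rho y)%:C * kappa * (U y).1)) (fun y => mu y * T (du y))) => //.
  - rewrite E2 => y Iy; apply: cvgN; apply: cvgM; first exact: crho.
    exact: cTk.
  - exact: measurable_funM.
  - by apply: (ae_imp _ wE) => y H Iy; rewrite (H Iy) TZl.
  - move=> phi tphi; have := congr1 T (weak phi tphi).
    rewrite Tint => E; rewrite -[RHS](_ : T 0 = 0); last first.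
      by rewrite -[X in T X](subrr 0) TB subrr.
    rewrite -E; apply: eq_Rintegral => y _.
    rewrite TB !TZ TZl [T (- _ * _ * _)](congr1 (@^~ y) E2)/=.
    by rewrite -(mulrA (rho y)%:C) TZl mulNr.
have [mr mi] := mdu.
move=> x Ix.
have [||||||||ur wr] := part (@complex.Re R) _ _ _ _ _ _ _ _ x Ix => //.
- by move=> a b; rewrite cReB.
- by case.
- by move=> a r; rewrite cReM /= mulr0 subr0.
- move=> y Iy; have E : (fun x => complex.Re (kappa * (U x).1)) =
    (fun x => complex.Re kappa * complex.Re (U x).1 - complex.Im kappa * complex.Im (U x).1).
    by apply/funext => t; rewrite cReM.
  rewrite E; apply: cvgB; (apply: cvgM; first exact: cvg_cst).
    exact: (inI _ cur).
  exact: (inI _ cui).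
have [||||||||ui wi] := part (@complex.Im R) _ _ _ _ _ _ _ _ x Ix => //.
- by move=> a b; rewrite cImB.
- by case.
- by move=> a r; rewrite cImM /= mulr0 add0r.
- move=> y Iy; have E : (fun x => complex.Im (kappa * (U x).1)) =
    (fun x => complex.Re kappa * complex.Im (U x).1 + complex.Im kappa * complex.Re (U x).1).
    by apply/funext => t; rewrite cImM.
  rewrite E; apply: cvgD; (apply: cvgM; first exact: cvg_cst).
    exact: (inI _ cui).
  exact: (inI _ cur).
Qed.

End WeakToClassical.

(** * Wronskian and energy flux *)

Section SturmLiouville.
Context {R : realType}.
Local Notation C := R[i].
Local Notation leb := (@lebesgue_measure R).
Local Notation normc := Normc.normc.
Local Notation Re := (@complex.Re R).
Local Notation Im := (@complex.Im R).
Implicit Types (mu rho : R -> R) (U V : R -> C * C) (kappa a b : C) (L z : R).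

(** The second-order equation as a first-order system for [(u, mu u')], which
    requires no derivative of [mu]. *)
Definition solves L mu rho kappa U :=
  [/\ ccont `[0, L] (fun x => (U x).1), ccont `[0, L] (fun x => (U x).2) &
      forall x, 0 < x < L ->
        cderiv (fun y => (U y).1) x ((mu x)^-1%:C * (U x).2) /\
        cderiv (fun y => (U y).2) x (- (rho x)%:C * kappa * (U x).1)].

Lemma segment_sub_closure L : 0 < L -> `[0, L] `<=` closure (`]0, L[%classic : set R).
Proof.
move=> L0 x /=; rewrite in_itv/= => xL B /nbhs_ballP[e /= e0 eB].
have [y [yL yx]] : exists y, 0 < y < L /\ `|x - y| < e.
  have [xl|Lx] := ltP x (L / 2).
    exists (x + Num.min e (L / 2) / 2).
    have : 0 < Num.min e (L / 2) by rewrite lt_min e0/= divr_gt0.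
    have : Num.min e (L / 2) <= e by rewrite ge_min lexx.
    have : Num.min e (L / 2) <= L / 2 by rewrite ge_min lexx orbT.
    by move=> *; split; [lra|rewrite ltr_norml; lra].
  exists (x - Num.min e (L / 2) / 2).
  have : 0 < Num.min e (L / 2) by rewrite lt_min e0/= divr_gt0.
  have : Num.min e (L / 2) <= e by rewrite ge_min lexx.
  have : Num.min e (L / 2) <= L / 2 by rewrite ge_min lexx orbT.
  by move=> *; split; [lra|rewrite ltr_norml; lra].
by exists y; split; [rewrite /= in_itv|exact: eB].
Qed.

Lemma weak_solution_solves I mu rho kappa U L : open I -> 0 < L ->
  `]0, L[ `<=` I -> continuous mu -> (forall x, 0 < mu x) -> continuous rho ->
  weak_solution I mu rho kappa U -> solves L mu rho kappa U.
Proof.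
move=> oI L0 LI cmu mu0 crho wU.
have [du [_ cu cw _ _]] := wU.
have LcI : `[0, L] `<=` closure I.
  by apply: subset_trans (closure_subset LI); exact: segment_sub_closure.
split.
- exact: ccontS LcI (ccont_continuous cu).
- exact: ccontS LcI (ccont_continuous cw).
- move=> x xL; apply: (weak_solution_ode oI cmu mu0 crho wU).
  by apply: LI; rewrite /= in_itv.
Qed.

Definition lin_comb a U b V : R -> C * C :=
  fun x => (a * (U x).1 + b * (V x).1, a * (U x).2 + b * (V x).2).

Lemma solves_lin_comb L mu rho kappa a U b V :
  solves L mu rho kappa U -> solves L mu rho kappa V ->
  solves L mu rho kappa (lin_comb a U b V).
Proof.
move=> [cu cw dU] [cv ct dV]; split.
- by apply: ccontD; apply: ccontM => //; exact: ccont_cst.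
- by apply: ccontD; apply: ccontM => //; exact: ccont_cst.
- move=> x xL; have [du dw] := dU x xL; have [dv dt] := dV x xL.
  split; apply: cderiv_eq.
  + exact: cderivD (cderivM (cderiv_cst a x) du) (cderivM (cderiv_cst b x) dv).
  + by rewrite /=; ring.
  + exact: cderivD (cderivM (cderiv_cst a x) dw) (cderivM (cderiv_cst b x) dt).
  + by rewrite /=; ring.
Qed.

Definition wronskian U V x : C := (U x).2 * (V x).1 - (U x).1 * (V x).2.

(** Up to the factor [4 z], the energy that crosses [x] from left to right; see
    [robin_flux]. *)
Definition flux U x : R := Im ((U x).2 * conjc (U x).1).

Lemma cderiv_wronskian L mu rho kappa kappa' U V x :
  solves L mu rho kappa U -> solves L mu rho kappa' V -> 0 < x < L ->
  cderiv (wronskian U V) x (- (rho x)%:C * (kappa - kappa') * (U x).1 * (V x).1).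
Proof.
move=> [_ _ dU] [_ _ dV] xL; have [du dw] := dU x xL; have [dv dt] := dV x xL.
apply: cderiv_eq (cderivB (cderivM dw dv) (cderivM du dt)) _; ring.
Qed.

Lemma ccont_wronskian L mu rho kappa kappa' U V :
  solves L mu rho kappa U -> solves L mu rho kappa' V ->
  ccont `[0, L] (wronskian U V).
Proof.
move=> [cu cw _] [cv ct _].
have -> : wronskian U V =
    fun x => (U x).2 * (V x).1 + (- 1) * ((U x).1 * (V x).2).
  by apply/funext => x; rewrite /wronskian; ring.
by apply: ccontD; [|apply: ccontM; [exact: ccont_cst|]]; exact: ccontM.
Qed.

(** The term [|mu u'|^2 / mu] is real, so only the absorption contributes. *)
Lemma derive_flux L mu rho kappa U x : solves L mu rho kappa U -> 0 < x < L ->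
  is_derive x 1 (flux U) (- (rho x * Im kappa * normc (U x).1 ^+ 2)).
Proof.
move=> [_ _ dU] xL; have [du dw] := dU x xL.
have [_ dE] := cderivM dw (cderivJ du).
apply: (is_derive_ext dE) => //.
rewrite normc_sqr; case: (U x) => -[u1 u2] [w1 w2]; case: kappa {dU du dw dE} => k1 k2.
by rewrite /=; ring.
Qed.

Lemma cont_flux L mu rho kappa U : solves L mu rho kappa U ->
  {within `[0, L], continuous (flux U)}.
Proof. by move=> [cu cw _]; have [] := ccontM cw (ccontJ cu). Qed.

Lemma flux_nonincreasing L mu rho kappa U : 0 < L -> (forall x, 0 < rho x) ->
  0 <= Im kappa -> solves L mu rho kappa U -> flux U L <= flux U 0.
Proof.
move=> L0 rho0 k0 sU.
have dE x : x \in `]0, L[ -> is_derive x 1 (flux U)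
    (- (rho x * Im kappa * normc (U x).1 ^+ 2)).
  by rewrite in_itv/=; exact: derive_flux sU.
have [x _ E] := MVT L0 dE (cont_flux sU).
rewrite -subr_le0 E subr0 mulNr oppr_le0.
by rewrite mulr_ge0 ?(ltW L0)// mulr_ge0 ?sqr_ge0// mulr_ge0// ltW.
Qed.

Lemma flux_constant L mu rho kappa U : 0 < L ->
  Im kappa = 0 -> solves L mu rho kappa U -> flux U L = flux U 0.
Proof.
move=> L0 k0 sU.
have dE x : x \in `]0, L[ -> is_derive x 1 (flux U)
    (- (rho x * Im kappa * normc (U x).1 ^+ 2)).
  by rewrite in_itv/=; exact: derive_flux sU.
have [x _ E] := MVT L0 dE (cont_flux sU).
by apply/eqP; rewrite -subr_eq0 E k0 mulr0 mul0r oppr0 mul0r.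
Qed.

(** Young's inequality bounds the derivative, of modulus [eps rho |u v|], of the
    Wronskian by [eta] times the absorption of [U], which integrates to the drop of
    its flux, plus a multiple of [eps / eta].  With [eta = sqrt eps] both contributions
    vanish as soon as the flux drop stays bounded. *)
Lemma wronskian_increment L mu rho kappa kappa' U V (ep eta M : R) : 0 < L ->
  (forall x, 0 < rho x) -> 0 < ep -> 0 < eta ->
  Im kappa = ep -> kappa - kappa' = 0 +i* ep ->
  solves L mu rho kappa U -> solves L mu rho kappa' V ->
  (forall x, 0 < x < L -> rho x * normc (V x).1 ^+ 2 <= M) ->
  normc (wronskian U V L - wronskian U V 0) <=
    2 * (eta * (flux U 0 - flux U L) + ep * M * L / (4 * eta)).
Proof.
move=> L0 rho0 ep0 eta0 kE kk' sU sV VM.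
set B := eta * (flux U 0 - flux U L) + ep * M * L / (4 * eta).
(* [G + eta * flux] has a derivative bounded by a constant: the flux absorbs
   the quadratic term in [u]. *)
have key (G g : R -> R) : {within `[0, L], continuous G} ->
    (forall x, 0 < x < L -> is_derive x 1 G (g x)) ->
    (forall x, 0 < x < L ->
      g x <= rho x * ep * (normc (U x).1 * normc (V x).1)) -> G L - G 0 <= B.
  move=> cG dG gb.
  have [||x xL E] := @MVT R (fun x => G x + eta * flux U x)
    (fun x => g x + eta * - (rho x * Im kappa * normc (U x).1 ^+ 2)) 0 L L0.
  - move=> x; rewrite in_itv/= => xL.
    exact: is_derive1D (dG x xL) (is_derive1Z _ (derive_flux sU xL)).
  - move=> x; apply: cvgD; first exact: cG.
    by apply: cvgM; [exact: cvg_cst|exact: (cont_flux sU)].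
  have {}xL : 0 < x < L by move: xL; rewrite in_itv.
  have : g x + eta * - (rho x * Im kappa * normc (U x).1 ^+ 2) <= ep * M / (4 * eta).
    apply: le_trans (_ : ep * (rho x * normc (V x).1 ^+ 2) / (4 * eta) <= _); last first.
      by rewrite ler_pM2r ?invr_gt0 ?mulr_gt0// ler_pM2l// VM.
    rewrite kE; have := gb x xL; have r0 := rho0 x.
    set p := normc _; set q := normc _ => gx.
    have : 0 <= rho x * ep * (eta * (p - q / (2 * eta)) ^+ 2).
      apply: mulr_ge0; first by apply: mulr_ge0; exact: ltW.
      by apply: mulr_ge0; [exact: ltW|exact: sqr_ge0].
    have -> : rho x * ep * (eta * (p - q / (2 * eta)) ^+ 2) =
        rho x * ep * (eta * p ^+ 2) - rho x * ep * (p * q) +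
        ep * (rho x * q ^+ 2) / (4 * eta).
      by field; rewrite gt_eqF.
    lra.
  move=> H; have : G L + eta * flux U L - (G 0 + eta * flux U 0) <= ep * M / (4 * eta) * L.
    by rewrite E subr0 ler_pM2r.
  rewrite /B; have -> : ep * M / (4 * eta) * L = ep * M * L / (4 * eta) by ring.
  lra.
have [cr ci] := ccont_wronskian sU sV.
have dW x : 0 < x < L -> cderiv (wronskian U V) x
    (- (rho x)%:C * (0 +i* ep) * (U x).1 * (V x).1).
  by rewrite -kk'; exact: cderiv_wronskian sU sV.
have nW x : normc (- (rho x)%:C * (0 +i* ep) * (U x).1 * (V x).1) =
    rho x * ep * (normc (U x).1 * normc (V x).1).
  rewrite !Normc.normcM normcN mulrA; congr (_ * _ * _ * _) => /=.
    by rewrite expr0n/= addr0 sqrtr_sqr gtr0_norm.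
  by rewrite expr0n/= add0r sqrtr_sqr gtr0_norm.
have key2 (T : C -> R) (T0 : forall a, `|T a| <= normc a)
    (cT : {within `[0, L], continuous (fun x => T (wronskian U V x))})
    (dT : forall x, 0 < x < L -> is_derive x 1 (fun x => T (wronskian U V x))
       (T (- (rho x)%:C * (0 +i* ep) * (U x).1 * (V x).1))) :
   `|T (wronskian U V L) - T (wronskian U V 0)| <= B.
  rewrite ler_norml; apply/andP; split.
    rewrite lerNl opprB -[X in X <= _]opprK opprB -[X in X <= _]mulN1r mulrBr.
    apply: (key _ _ _ (fun x xL => is_derive1Z (-1) (dT x xL))).
      by move=> x; apply: cvgM; [exact: cvg_cst|exact: cT].
    move=> x xL; rewrite mulN1r -nW; apply: le_trans (T0 _).
    by rewrite -normrN ler_norm.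
  apply: (key _ _ cT dT) => x xL; rewrite -nW; apply: le_trans (T0 _).
  exact: ler_norm.
have Wr := key2 Re Re_le_normc cr (fun x xL => (dW x xL).1).
have Wi := key2 Im Im_le_normc ci (fun x xL => (dW x xL).2).
apply: le_trans (normc_le_ReIm _) _.
by rewrite cReB cImB mulr2n mulrDl !mul1r lerD.
Qed.

End SturmLiouville.

(** * Translations, Robin data and solutions on the half-line *)

Section Translation.
Context {R : realType}.
Local Notation leb := (@lebesgue_measure R).
Local Notation translation s := ((fun x => x + s) : measurableTypeR R -> measurableTypeR R).

Lemma measurable_translation (s : R) :
  measurable_fun setT (translation s).
Proof.
by apply: continuous_measurable_fun => x; apply: cvgD; [exact: cvg_id|exact: cvg_cst].
Qed.

Lemma lebesgue_measure_translation (s : R) (A : set R) : measurable A ->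
  pushforward leb (translation s) A = leb A.
Proof.
move=> mA; apply/esym.
pose f := translation s.
pose F := isMeasurableFun.Build _ _ _ _ f (measurable_translation s).
pose mf : {mfun measurableTypeR R >-> measurableTypeR R} := HB.pack f F.
apply: (@lebesgue_measure_unique R (pushforward leb mf)) => //= _ [[a b]] _ <-.
rewrite /pushforward/=.
have -> : mf @^-1` `]a, b]%classic = `]a - s, b - s]%classic.
  by apply/seteqP; split => x /=; rewrite !in_itv/= ltrBlDr lerBrDr.
by rewrite !lebesgue_measure_itv/= !lte_fin ltrD2r -!EFinB; congr (if _ then _ else _); congr EFin; ring.
Qed.

Lemma ge0_integral_translation (s : R) (D : set R) (f : R -> \bar R) :
  measurable D -> measurable_fun D f -> (forall x, D x -> 0 <= f x)%E ->
  (\int[leb]_(x in D) f x = \int[leb]_(x in [set x : R | D (x + s)%R]) f (x + s)%R)%E.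
Proof.
move=> mD mf f0.
pose F := isMeasurableFun.Build _ _ _ _ _ (measurable_translation s).
pose mt : {mfun measurableTypeR R >-> measurableTypeR R} := HB.pack (translation s) F.
transitivity (\int[pushforward leb mt]_(x in D) f x)%E.
  apply: eq_measure_integral => A mA _.
  exact/esym/(@lebesgue_measure_translation s A mA).
rewrite (ge0_integral_pushforward (measurable_translation s) leb mD mf)//.
by move=> y; rewrite inE; exact: f0.
Qed.

Lemma measurable_fun_translation (s : R) (D : set R) (f : R -> R) :
  measurable D -> measurable_fun D f ->
  measurable_fun [set x | D (x + s)] (fun x => f (x + s)).
Proof.
move=> mD mf.
apply: (@measurable_comp _ _ _ _ _ _ D f _ (translation s)) => //.
- by move=> _ [x /= Dx <-].
- by apply: measurable_funTS; exact: measurable_translation.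
Qed.

Lemma ae_translation (s : R) (P : R -> Prop) :
  {ae leb, forall x, P x} -> {ae leb, forall x, P (x + s)}.
Proof.
move=> [N [mN N0 sN]]; exists (translation s @^-1` N); split.
- by rewrite -[X in measurable X]setTI; exact: measurable_translation.
- by rewrite -[RHS]N0; exact: lebesgue_measure_translation.
- by move=> x nP; exact: sN.
Qed.

End Translation.

Section Robin.
Context {R : realType}.
Local Notation C := R[i].
Local Notation leb := (@lebesgue_measure R).
Local Notation normc := Normc.normc.
Local Notation Re := (@complex.Re R).
Local Notation Im := (@complex.Im R).
Implicit Types (mu rho : R -> R) (U V : R -> C * C) (kappa a b : C) (L z x : R).
Local Notation rp z := (robin_plus z right_side).
Local Notation rm z := (robin_minus z right_side).
Local Notation half := (@half_line R right_side).

(** Robin data are a linear change of the Cauchy data [(u, mu u')], so the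
    Wronskian is, up to its determinant, the determinant of the Robin data. *)
Lemma robin_wronskian z U V x :
  rp z U x * rm z V x - rm z U x * rp z V x = 2 * (0 +i* z) * wronskian U V x.
Proof. by rewrite /robin_plus /robin_minus /wronskian /sgn rmorph1; ring. Qed.

(** [rp] and [rm] act as amplitudes of right-going and left-going waves, and the
    flux is the difference of their energies. *)
Lemma robin_flux z U x :
  normc (rp z U x) ^+ 2 - normc (rm z U x) ^+ 2 = 4 * z * flux U x.
Proof.
rewrite !normc_sqr /robin_plus /robin_minus /flux /sgn.
by case: (U x) => -[u1 u2] [w1 w2] /=; ring.
Qed.

Lemma robin_plus_comb z a U b V x :
  rp z (lin_comb a U b V) x = a * rp z U x + b * rp z V x.
Proof. by rewrite /robin_plus /lin_comb/=; ring. Qed.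

Lemma robin_minus_comb z a U b V x :
  rm z (lin_comb a U b V) x = a * rm z U x + b * rm z V x.
Proof. by rewrite /robin_minus /lin_comb/=; ring. Qed.

Definition density U x : R := normc (U x).1 ^+ 2 + normc (U x).2 ^+ 2.

Lemma density_ge0 U x : 0 <= density U x.
Proof. by rewrite addr_ge0 ?sqr_ge0. Qed.

Lemma flux_le_density U x : `|flux U x| <= density U x.
Proof.
rewrite /flux /density; apply: le_trans (Im_le_normc _) _.
have -> : normc ((U x).2 * conjc (U x).1) = normc (U x).2 * normc (U x).1.
  by rewrite Normc.normcM; congr (_ * _); case: (U x).1 => p q /=; rewrite sqrrN.
have := sqr_ge0 (normc (U x).2 - normc (U x).1).
have := normc_ge0 (U x).2; have := normc_ge0 (U x).1; nra.
Qed.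

Lemma normcD_sqr (a b : C) : normc (a + b) ^+ 2 <= 2 * normc a ^+ 2 + 2 * normc b ^+ 2.
Proof.
rewrite !normc_sqr cReD cImD; case: a => p q; case: b => r s /=.
have := sqr_ge0 (p - r); have := sqr_ge0 (q - s); nra.
Qed.

Lemma density_comb a U b V x : density (lin_comb a U b V) x <=
  2 * normc a ^+ 2 * density U x + 2 * normc b ^+ 2 * density V x.
Proof.
rewrite /density/=.
have := normcD_sqr (a * (U x).1) (b * (V x).1).
have := normcD_sqr (a * (U x).2) (b * (V x).2).
rewrite !Normc.normcM !exprMn; lra.
Qed.

(** The flux is nonincreasing, so a negative value at [0] would bound it away
    from [0] on the whole half-line, contradicting integrability. *)
Lemma flux_ge0 mu rho kappa U (h : R -> R) : (forall x, 0 < rho x) ->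
  0 <= Im kappa -> (forall L, 0 < L -> solves L mu rho kappa U) ->
  measurable_fun half h ->
  (\int[leb]_(x in half) (h x)%:E < +oo)%E ->
  (forall x, 0 < x -> `|flux U x| <= h x) -> 0 <= flux U 0.
Proof.
move=> rho0 k0 sU mh hfin fh; rewrite leNgt; apply/negP => f0.
have : (\int[leb]_(x in half) (- flux U 0)%:E <=
    \int[leb]_(x in half) (h x)%:E)%E.
  apply: ge0_le_integral.
  - exact: measurable_itv.
  - by move=> x _; rewrite lee_fin oppr_ge0 ltW.
  - exact: measurable_cst.
  - exact/measurable_EFinP.
  - move=> x; rewrite /half_line/= in_itv/= andbT => x0; rewrite lee_fin.
    apply: le_trans (fh x x0); rewrite -normrN; apply: le_trans (ler_norm _).
    by rewrite lerN2; exact: flux_nonincreasing (sU x x0).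
have -> : (\int[leb]_(x in half) (- flux U 0)%:E = +oo)%E.
  rewrite /half_line integral_cst//= lebesgue_measure_itv/=.
  by rewrite ltry/= gt0_muley// lte_fin oppr_gt0.
by rewrite leNgt hfin.
Qed.

Lemma sqrte_lty (x : \bar R) : (sqrte x < +oo -> x < +oo)%E.
Proof. by case: x => [r _|//=|_]; rewrite ?ltry. Qed.

(** [mu u'] is square integrable because [u'] is and [mu] is bounded above. *)
Lemma weak_solution_density mu rho kappa U (M : R) :
  continuous mu -> (forall x, 0 < mu x <= M) ->
  weak_solution half mu rho kappa U ->
  measurable_fun half (density U) /\
  (\int[leb]_(x in half) (density U x)%:E < +oo)%E.
Proof.
move=> cmu muM [du [[[mu1 u2] [mdu du2] _] cu cw wE _]].
have mhalf : measurable half by exact: measurable_itv.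
have mw : cmeasurable half (fun x => (U x).2).
  have [wr wi] := ccontS (@subset_closure _ half) (ccont_continuous cw).
  by split; exact: subspace_continuous_measurable_fun.
have md : measurable_fun half (density U).
  by apply: measurable_funD; exact: measurable_normc_sqr.
split => //.
have {u2} u2 : (\int[leb]_(x in half) (normc (U x).1 ^+ 2)%:E < +oo)%E.
  by move/sqrte_lty: u2; under eq_integral do rewrite /= mul1r.
have {du2} du2 : (\int[leb]_(x in half) (normc (du x) ^+ 2)%:E < +oo)%E.
  by move/sqrte_lty: du2; under eq_integral do rewrite /= mul1r.
pose h x := normc (U x).1 ^+ 2 + M ^+ 2 * normc (du x) ^+ 2.
have mdu2 := measurable_normc_sqr mdu; have mu2 := measurable_normc_sqr mu1.
apply: (@le_lt_trans _ _ (\int[leb]_(x in half) (h x)%:E)%E).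
  apply: ae_ge0_le_integral => //.
  - by move=> x _; rewrite lee_fin density_ge0.
  - exact/measurable_EFinP.
  - by move=> x _; rewrite lee_fin /h; apply: addr_ge0; [exact: sqr_ge0|apply: mulr_ge0; exact: sqr_ge0].
  - apply/measurable_EFinP; apply: measurable_funD => //.
    exact: measurable_funM.
  - apply: (ae_imp _ wE) => x H Ix; rewrite lee_fin /density /h lerD2l (H Ix).
    rewrite Normc.normcM exprMn ler_wpM2r ?sqr_ge0//= expr0n/= addr0 sqrtr_sqr.
    have /andP[m0 mM] := muM x.
    by rewrite real_normK ?num_real// ler_sqr ?nnegrE// ?ltW//; lra.
under eq_integral do rewrite EFinD.
rewrite ge0_integralD//=.
- apply: lte_add_pinfty => //.
  under eq_integral do rewrite EFinM.
  rewrite ge0_integralZl//=; last 3 first.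
  + exact/measurable_EFinP.
  + by move=> x _; rewrite lee_fin sqr_ge0.
  + by rewrite lee_fin sqr_ge0.
  by apply: lte_mul_pinfty => //; rewrite lee_fin sqr_ge0.
- by move=> x _; rewrite lee_fin sqr_ge0.
- exact/measurable_EFinP.
- by move=> x _; rewrite lee_fin mulr_ge0 ?sqr_ge0.
- by apply/measurable_EFinP; exact: measurable_funM.
Qed.

Lemma cderiv_translation (f : R -> C) s x a :
  cderiv f (x + s) a -> cderiv (fun y => f (y + s)) x a.
Proof.
have ds : is_derive x 1 (fun y : R => y + s) 1.
  by apply: is_derive_eq (is_derive1D (is_derive_id x 1) (is_derive1_cst s x)) _; rewrite addr0.
move=> [fr fi]; split.
- apply: (is_derive_ext (@is_derive1_comp R _ (fun y => y + s) x _ _ fr ds)) => //.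
  by rewrite mulr1.
- apply: (is_derive_ext (@is_derive1_comp R _ (fun y => y + s) x _ _ fi ds)) => //.
  by rewrite mulr1.
Qed.

Lemma solves_translation mu rho kappa U s : 0 < s ->
  (forall L, 0 < L -> solves L mu rho kappa U) ->
  forall L, 0 < L ->
  solves L (fun x => mu (x + s)) (fun x => rho (x + s)) kappa (fun x => U (x + s)).
Proof.
move=> s0 sU L L0.
have dU x : - s < x ->
    cderiv (fun y => (U (y + s)).1) x ((mu (x + s))^-1%:C * (U (x + s)).2) /\
    cderiv (fun y => (U (y + s)).2) x (- (rho (x + s))%:C * kappa * (U (x + s)).1).
  move=> sx; have T0 : 0 < x + s + 1 by lra.
  have [_ _ /(_ (x + s))] := sU _ T0; case; first by lra.
  move=> du dw; split.
    exact: (@cderiv_translation (fun y => (U y).1)).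
  exact: (@cderiv_translation (fun y => (U y).2)).
have cc (f : R -> C) : (forall x, - s < x -> exists a, cderiv f x a) -> ccont `[0, L] f.
  move=> df; split; apply/continuous_in_subspaceT => x; rewrite inE/= in_itv/= => xL.
    by have [|a [fr _]] := df x; [lra|exact: is_derive1_continuous fr].
  by have [|a [_ fi]] := df x; [lra|exact: is_derive1_continuous fi].
split.
- by apply: cc => x /dU[du _]; eexists; exact: du.
- by apply: cc => x /dU[_ dw]; eexists; exact: dw.
- by move=> x xL; apply: dU; lra.
Qed.

Lemma density_translation U s : 0 <= s ->
  measurable_fun half (density U) -> (\int[leb]_(x in half) (density U x)%:E < +oo)%E ->
  measurable_fun half (density (fun x => U (x + s))) /\
  (\int[leb]_(x in half) (density (fun x => U (x + s)) x)%:E < +oo)%E.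
Proof.
move=> s0 mU iU.
pose tail : set R := [set` `]s, +oo[%R].
have mtail : measurable tail by exact: measurable_itv.
have tail_sub : tail `<=` half.
  by move=> x; rewrite /tail /half_line/= !in_itv/= !andbT => sx; exact: le_lt_trans sx.
have mT : measurable_fun tail (density U) by apply: measurable_funS mU => //; exact: measurable_itv.
have tailE : [set x | tail (x + s)] = half.
  by apply/seteqP; split => x; rewrite /tail /half_line/= !in_itv/= !andbT ltrDr.
split; first by have := @measurable_fun_translation R s tail _ mtail mT; rewrite tailE.
have -> : (\int[leb]_(x in half) (density (fun x => U (x + s)) x)%:E =
    \int[leb]_(x in tail) (density U x)%:E)%E.
  rewrite [RHS](@ge0_integral_translation R s) ?tailE//.
    exact/measurable_EFinP.
  by move=> x _; rewrite lee_fin density_ge0.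
apply: le_lt_trans iU; apply: ge0_subset_integral => //.
- exact: measurable_itv.
- exact/measurable_EFinP.
- by move=> x _; rewrite lee_fin density_ge0.
Qed.

(** The combination [d = U - rp U(0) V] has no incoming datum, so its flux at
    [0] is minus the squared modulus of its outgoing datum; being also
    nonnegative, it is zero. *)
Lemma robin_minus_proportional z mu rho kappa U V : 0 < z ->
  (forall x, 0 < rho x) -> 0 <= Im kappa ->
  (forall L, 0 < L -> solves L mu rho kappa U) ->
  (forall L, 0 < L -> solves L mu rho kappa V) ->
  measurable_fun half (density U) -> (\int[leb]_(x in half) (density U x)%:E < +oo)%E ->
  measurable_fun half (density V) -> (\int[leb]_(x in half) (density V x)%:E < +oo)%E ->
  rp z V 0 = 1 -> rm z U 0 = rp z U 0 * rm z V 0.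
Proof.
move=> z0 rho0 k0 sU sV mU iU mV iV V1.
pose p := rp z U 0; pose d := lin_comb 1 U (- p) V.
have sd L : 0 < L -> solves L mu rho kappa d.
  by move=> L0; apply: solves_lin_comb; [exact: sU|exact: sV].
have d0 : rp z d 0 = 0 by rewrite robin_plus_comb V1 mul1r mulr1 subrr.
pose h x := 2 * density U x + 2 * normc (- p) ^+ 2 * density V x.
have mhalf : measurable half by exact: measurable_itv.
have f0 : 0 <= flux d 0.
  apply: (@flux_ge0 mu rho kappa d h) => //.
  - by apply: measurable_funD; exact: measurable_funM.
  - rewrite /h; under eq_integral do rewrite EFinD.
    have Zfin (k : R) (g : R -> R) : 0 <= k -> measurable_fun half g ->
        (forall x, 0 <= g x) -> (\int[leb]_(x in half) (g x)%:E < +oo)%E ->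
        (\int[leb]_(x in half) (k * g x)%:E < +oo)%E.
      move=> k0' mg g0 gfin; under eq_integral do rewrite EFinM.
      rewrite ge0_integralZl//=.
      + by apply: lte_mul_pinfty => //; rewrite lee_fin.
      + exact/measurable_EFinP.
      + by move=> x _; rewrite lee_fin.
    rewrite ge0_integralD//=.
    + apply: lte_add_pinfty; apply: Zfin => //; try by move=> x; exact: density_ge0.
      by rewrite mulr_ge0// sqr_ge0.
    + by move=> x _; rewrite lee_fin mulr_ge0// density_ge0.
    + by apply/measurable_EFinP; exact: measurable_funM.
    + move=> x _; rewrite lee_fin; apply: mulr_ge0; last exact: density_ge0.
      by apply: mulr_ge0 => //; exact: sqr_ge0.
    + by apply/measurable_EFinP; exact: measurable_funM.
  - move=> x _; apply: le_trans (flux_le_density _ _) _.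
    apply: le_trans (density_comb _ _ _ _ _) _.
    by rewrite Normc.normc1 expr1n mulr1.
have := robin_flux z d 0; rewrite d0 Normc.normc0 expr0n/= sub0r => E.
have m0 : normc (rm z d 0) ^+ 2 <= 0.
  by rewrite -oppr_ge0 E mulr_ge0// mulr_ge0// ltW.
have /eqP : rm z d 0 = 0.
  by apply: Normc.eq0_normc; apply/eqP; rewrite -sqrf_eq0 eq_le m0 sqr_ge0.
by rewrite robin_minus_comb mul1r mulNr subr_eq0 => /eqP.
Qed.

End Robin.

(** * Irrational rotations and periodic functions *)

Section Periodicity.
Context {R : realType}.
Implicit Types (d s e : R).

Lemma frac_bounds (x : R) : 0 <= x - (Num.floor x)%:~R < 1.
Proof. by have := floor_itv x; rewrite intrD; lra. Qed.

(** Pigeonhole principle: among [N + 1] fractional parts of multiples of [d], two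
    lie in the same interval of length [1 / N]. *)
Lemma small_multiple d e : irrational d -> 0 < e ->
  exists (q : nat) (p : int), 0 < `|q%:R * d + p%:~R| < e.
Proof.
move=> dirr e0.
pose N := Num.bound e^-1.
have eN : e^-1 < N%:R by apply: archi_boundP; rewrite invr_ge0 ltW.
have N0 : 0 < N%:R :> R by apply: lt_trans eN; rewrite invr_gt0.
pose fr (j : nat) := j%:R * d - (Num.floor (j%:R * d))%:~R.
have frb j : 0 <= N%:R * fr j < N%:R.
  have /andP[f0 f1] := frac_bounds (j%:R * d).
  by rewrite mulr_ge0 ?(ltW N0)//= -[ltRHS]mulr1 ltr_pM2l.
have bP j : (`|Num.floor (N%:R * fr j)|%N < N)%N.
  have /andP[f0 f1] := frb j.
  by rewrite -ltz_nat gez0_abs ?floor_ge0// floor_lt_int.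
pose f (j : 'I_N.+1) : 'I_N := Ordinal (bP j).
have /injectivePn[i [j ij fij]] : ~~ injectiveb f.
  apply/negP => /injectiveP/leq_card; rewrite !card_ord ltnn//.
have {fij} fij : Num.floor (N%:R * fr i) = Num.floor (N%:R * fr j).
  move/(congr1 val): fij => /= /(congr1 Posz).
  by rewrite !gez0_abs ?floor_ge0//; [have /andP[] := frb j|have /andP[] := frb i].
have {fij} fclose : `|fr i - fr j| < e.
  have := floor_itv (N%:R * fr i); have := floor_itv (N%:R * fr j).
  rewrite fij intrD => h1 h2.
  have : `|N%:R * fr i - N%:R * fr j| < 1 by rewrite ltr_norml; lra.
  rewrite -mulrBr normrM gtr0_norm// => h3.
  rewrite -(ltr_pM2l N0); apply: lt_trans h3 _.
  by rewrite -ltr_pdivrMr// div1r.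
wlog lij : i j ij fclose / (i < j)%N.
  move=> H; have [/H|/H|/val_inj] := ltngtP i j.
  - exact.
  - by apply; [rewrite eq_sym|rewrite distrC].
  - by move=> /eqP; rewrite (negbTE ij).
exists (j - i)%N, (Num.floor (i%:R * d) - Num.floor (j%:R * d)).
have -> : (j - i)%:R * d + (Num.floor (i%:R * d) - Num.floor (j%:R * d))%:~R =
    fr j - fr i.
  by rewrite natrB ?(ltnW lij)// intrB /fr; ring.
rewrite distrC fclose andbT normr_gt0 subr_eq0; apply/negP => /eqP E.
apply: dirr; apply/rationalP.
exists (Num.floor (j%:R * d) - Num.floor (i%:R * d)), (j - i)%N.
have ji0 : (j - i)%:R != 0 :> R by rewrite pnatr_eq0 -lt0n subn_gt0.
apply: (mulIf ji0); rewrite divfK//.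
rewrite natrB ?(ltnW lij)// intrB; move: E; rewrite /fr; lra.
Qed.

Lemma nat_quotient (x y : R) : 0 <= x -> 0 < y ->
  exists n : nat, n%:R * y <= x < n%:R * y + y.
Proof.
move=> x0 y0; exists (Num.truncn (x / y)).
have := truncn_itv (divr_ge0 x0 (ltW y0)).
by rewrite ler_pdivlMr// ltr_pdivrMr// -natr1 mulrDl mul1r.
Qed.

(** Multiples of a small nonzero number [r = q d + p] come within [|r|] of any
    point on the side towards which they run.  The integer shift [b] places the
    starting point on the other side of [s], so nonnegative multiples suffice. *)
Lemma orbit_dense d s e : irrational d -> 0 < e ->
  exists (n : nat) (k : int), `|n%:R * d + k%:~R - s| < e.
Proof.
move=> dirr e0; have [q [p /andP[r0 re]]] := small_multiple dirr e0.
set r := _ + _ in r0 re.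
have [b [m sb]] : exists (b : int) (m : nat), `|m%:R * r + b%:~R - s| < `|r|.
  have := frac_bounds s; set fs := Num.floor s => sfs.
  have [rpos|rneg] := ltP 0 r.
    have [m sm] := @nat_quotient (s - fs%:~R) r ltac:(lra) rpos.
    by exists fs, m; rewrite (gtr0_norm rpos) ltr_norml; lra.
  have {}rneg : 0 < - r by rewrite oppr_gt0 lt_neqAle rneg andbT -normr_gt0.
  have [m sm] := @nat_quotient (fs%:~R + 1 - s) (- r) ltac:(lra) rneg.
  exists (fs + 1), m; rewrite -(normrN r) (gtr0_norm rneg) ltr_norml intrD.
  by move: sm; rewrite mulrN; lra.
exists (m * q)%N, (m%:Z * p + b).
have -> : (m * q)%:R * d + (m%:Z * p + b)%:~R - s = m%:R * r + b%:~R - s.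
  by rewrite natrM intrD intrM /r -pmulrn; ring.
exact: lt_trans re.
Qed.

Lemma periodic_int (T : Type) (f : R -> T) (k : int) s :
  (forall s, f (s + 1) = f s) -> f (s + k%:~R) = f s.
Proof.
move=> f1; have fn (n : nat) t : f (t + n%:R) = f t.
  by elim: n t => [|n IH] t; [rewrite addr0|rewrite -natr1 addrA f1 IH].
case: k => n; first exact: fn.
by rewrite NegzE mulrNz -[LHS](fn n.+1) subrK.
Qed.

Lemma periodic_frac (T : Type) (f : R -> T) s :
  (forall s, f (s + 1) = f s) -> f s = f (s - (Num.floor s)%:~R).
Proof. by move=> f1; rewrite -mulrNz periodic_int. Qed.

Lemma periodic_bounded (f : R -> R) : continuous f -> (forall s, f (s + 1) = f s) ->
  exists2 B, 0 <= B & forall s, `|f s| <= B.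
Proof.
move=> cf f1.
have /compact_bounded[M [_ HM]] :=
  continuous_compact (continuous_subspaceT cf) (@segment_compact R 0 1).
have MM := HM _ (ltr_pwDr ltr01 (ler_norm M)).
exists (`|M| + 1); first by rewrite addr_ge0.
move=> s; rewrite (periodic_frac _ f1); apply: MM => /=.
by exists (s - (Num.floor s)%:~R) => //; rewrite /= in_itv/= ; have := frac_bounds s; lra.
Qed.

Lemma periodic2_bounded (f : R * R -> R) : continuous f ->
  (forall x y, f (x + 1, y) = f (x, y)) -> (forall x y, f (x, y + 1) = f (x, y)) ->
  exists B, forall xy, f xy <= B.
Proof.
move=> cf fx fy.
have cpt : compact (`[(0 : R), 1] `*` `[(0 : R), 1]).
  by apply: compact_setX; exact: segment_compact.
have /compact_bounded[M [_ HM]] := continuous_compact (continuous_subspaceT cf) cpt.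
have MM := HM _ (ltr_pwDr ltr01 (ler_norm M)).
exists (`|M| + 1) => -[x y].
rewrite (@periodic_frac _ (fun x => f (x, y)) x)// (@periodic_frac _ (fun y => f (_, y)) y)//.
apply: le_trans (ler_norm _) _; apply: MM => /=.
eexists; last reflexivity.
by split; rewrite /= in_itv/=; have := frac_bounds x; have := frac_bounds y; lra.
Qed.

End Periodicity.

(** * Operators on periodic functions *)

Section Operators.
Context {R : realType}.
Local Notation C := R[i].
Local Notation leb := (@lebesgue_measure R).
Local Notation normc := Normc.normc.
Implicit Types (a b f phi psi : R -> C) (d c s : R).

(** The integral of a nonnegative function is a supremum over simple functions
    below it, hence monotone even on functions that are not measurable.  It is
    applied to weighted shifts whose symbols come with no regularity in [s]. *)
Lemma ge0_le_integral_any (D : set R) (g h : R -> \bar R) :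
  (forall x, D x -> 0 <= g x)%E -> (forall x, D x -> g x <= h x)%E ->
  (\int[leb]_(x in D) g x <= \int[leb]_(x in D) h x)%E.
Proof.
move=> g0 gh.
have h0 x : D x -> (0 <= h x)%E by move=> Dx; apply: le_trans (g0 x Dx) (gh x Dx).
rewrite !ge0_integralE//; apply: le_ereal_sup => _ [k /= kg <-]; exists k => //= x.
apply: le_trans (kg x) _; rewrite !patchE; case: ifPn => // xD.
by apply: gh; rewrite inE in xD.
Qed.

(** With [0 <= d < 1] after reduction modulo [1], the translation exchanges the
    pieces [[0, d[] and [[d, 1[] for [[1 - d, 1[] and [[0, 1 - d[]. *)
Lemma ge0_integral_periodic d (g : R -> R) : measurable_fun setT g ->
  (forall x, 0 <= g x) -> (forall x, g (x + 1) = g x) ->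
  (\int[leb]_(x in `[0%R, 1%R]) (g (x - d))%:E =
   \int[leb]_(x in `[0%R, 1%R]) (g x)%:E)%E.
Proof.
move=> mg g0 g1.
wlog d01 : d / 0 <= d < 1.
  move=> H; rewrite -(H _ (frac_bounds d)); apply: eq_integral => x _.
  by rewrite opprB addrA -(periodic_int (Num.floor d) (x - d) g1) addrAC.
have mgE (D : set R) : measurable_fun D (fun x => (g x)%:E).
  by apply/measurable_EFinP; exact: measurable_funTS.
have mgd (D : set R) : measurable_fun D (fun x : R => (g (x - d))%:E).
  apply/measurable_EFinP; apply: measurable_funTS.
  by apply: (@measurable_fun_translation R (- d) setT g).
rewrite -integral_itv_bndo_bndc// -[RHS]integral_itv_bndo_bndc//.
have split_at (k : R -> R) t : 0 <= t <= 1 -> measurable_fun setT k ->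
    (forall x, 0 <= k x) ->
    (\int[leb]_(x in `[0%R, 1%R[) (k x)%:E = \int[leb]_(x in `[0%R, t[) (k x)%:E +
      \int[leb]_(x in `[t, 1%R[) (k x)%:E)%E.
  move=> t01 mk k0; rewrite -ge0_integral_setU//=.
  - congr integral; apply/seteqP; split => x /=; rewrite !in_itv/=.
      by move=> x01; case: (ltP x t) => xt; [left|right]; lra.
    by case; lra.
  - by apply/measurable_EFinP; exact: measurable_funTS.
  - by move=> x _; rewrite lee_fin.
  - apply/disj_setPRL => x /=; rewrite !in_itv/= => /andP[tx _].
    by rewrite ltNge tx andbF.
rewrite (split_at _ d); [|lra|by have /measurable_EFinP := mgd setT|by move=> x; exact: g0].
rewrite [RHS](split_at _ (1 - d)) //; last by lra.
rewrite addeC; congr (_ + _)%E.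
- rewrite [RHS](@ge0_integral_translation R (- d))//; last by move=> x _; rewrite lee_fin.
  by congr integral; apply/seteqP; split => x /=; rewrite !in_itv/=; lra.
- rewrite [RHS](@ge0_integral_translation R (1 - d))//; last by move=> x _; rewrite lee_fin.
  transitivity (\int[leb]_(x in `[0%R, d[) (g (x + (1 - d)))%:E)%E.
    by apply: eq_integral => x _; rewrite -(g1 (x - d)); congr (g _)%:E; ring.
  by congr integral; apply/seteqP; split => x /=; rewrite !in_itv/=; lra.
Qed.

Lemma L2per_normE f : L2per_norm f =
  sqrte (\int[leb]_(x in `[0%R, 1%R]) (normc (f x) ^+ 2)%:E)%E.
Proof. by rewrite /L2per_norm /L2norm; congr sqrte; apply: eq_integral => x _; rewrite mul1r. Qed.

Lemma L2per_norm_ge0 f : (0 <= L2per_norm f)%E.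
Proof. exact: sqrte_ge0. Qed.

Lemma weighted_shift_norm_le a d c phi : 0 <= c -> (forall s, normc (a s) <= c) ->
  L2per phi -> (L2per_norm (weighted_shift a d phi) <= c%:E * L2per_norm phi)%E.
Proof.
move=> c0 ac [mphi phi1 _].
have mphi2 := measurable_normc_sqr mphi.
have cE : c%:E = sqrte (c ^+ 2)%:E by rewrite /= sqrtr_sqr ger0_norm.
rewrite !L2per_normE cE -sqrteM ?lee_fin ?sqr_ge0// lee_sqrt; last first.
  apply: mule_ge0; first by rewrite lee_fin sqr_ge0.
  by apply: integral_ge0 => x _; rewrite lee_fin sqr_ge0.
rewrite -(ge0_integral_periodic d mphi2); first last.
- by move=> x; rewrite phi1.
- by move=> x; exact: sqr_ge0.
rewrite -ge0_integralZl//=; first last.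
- by rewrite lee_fin sqr_ge0.
- by move=> x _; rewrite lee_fin sqr_ge0.
- apply/measurable_EFinP/measurable_funTS.
  exact: (@measurable_fun_translation R (- d) setT (fun x => normc (phi x) ^+ 2)).
apply: ge0_le_integral_any => x _; first by rewrite lee_fin sqr_ge0.
rewrite -EFinM lee_fin /weighted_shift Normc.normcM exprMn.
by rewrite ler_wpM2r ?sqr_ge0// lerXn2r ?nnegrE ?normc_ge0.
Qed.

Lemma opnorm_le (T : operator) c : 0 <= c ->
  (forall phi, L2per phi -> L2per_norm (T phi) <= c%:E * L2per_norm phi)%E ->
  (opnorm T <= c%:E)%E.
Proof.
move=> c0 Tc; apply: ge_ereal_sup => _ [phi [Lphi phi1] <-].
apply: le_trans (Tc phi Lphi) _.
by rewrite -[leRHS]mule1 lee_pmul// ?lee_fin// L2per_norm_ge0.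
Qed.

Lemma L2per_norm0 : L2per_norm (fun=> 0 : C) = 0%E.
Proof.
rewrite L2per_normE (eq_integral (cst 0%E)); first by rewrite integral0 sqrte0.
by move=> x _; rewrite Normc.normc0 expr0n.
Qed.

Lemma L2per0 : L2per (fun=> 0 : C).
Proof. by split; rewrite ?L2per_norm0 ?ltry//; split; exact: measurable_cst. Qed.

Lemma opnorm_ge0 (T : @operator R) : (0 <= opnorm T)%E.
Proof.
apply: le_trans (L2per_norm_ge0 (T (fun=> 0))) _; apply: ereal_sup_ubound.
by exists (fun=> 0) => //; split; [exact: L2per0|rewrite L2per_norm0].
Qed.

Lemma continuous_periodic_bounded f : continuous_periodic f ->
  exists2 B, 0 <= B & forall s, normc (f s) <= B.
Proof.
move=> [cf f1].
have [||r r0 fr] := @periodic_bounded R (fun s => complex.Re (f s)).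
- by move=> s; apply: (@continuous_comp _ _ _ f (@complex.Re R)); [exact: cf|exact: Re_continuous].
- by move=> s; rewrite f1.
have [||i i0 fi] := @periodic_bounded R (fun s => complex.Im (f s)).
- by move=> s; apply: (@continuous_comp _ _ _ f (@complex.Im R)); [exact: cf|exact: Im_continuous].
- by move=> s; rewrite f1.
by exists (r + i); rewrite ?addr_ge0// => s; apply: le_trans (normc_le_ReIm _) (lerD (fr s) (fi s)).
Qed.

Lemma continuous_cmeasurable f : continuous f -> cmeasurable setT f.
Proof.
move=> cf; split; apply: continuous_measurable_fun => s.
- by apply: (@continuous_comp _ _ _ f (@complex.Re R)); [exact: cf|exact: Re_continuous].
- by apply: (@continuous_comp _ _ _ f (@complex.Im R)); [exact: cf|exact: Im_continuous].
Qed.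

Lemma cmeasurable_shift f d : cmeasurable setT f -> cmeasurable setT (fun s => f (s - d)).
Proof.
move=> [mr mi]; split.
- exact: (@measurable_fun_translation R (- d) setT (fun s => complex.Re (f s))).
- exact: (@measurable_fun_translation R (- d) setT (fun s => complex.Im (f s))).
Qed.

Lemma cmeasurableM f g : cmeasurable setT f -> cmeasurable setT g ->
  cmeasurable setT (fun s => f s * g s).
Proof.
move=> [fr fi] [gr gi]; split.
- rewrite (_ : (fun s => _) = (fun s => complex.Re (f s) * complex.Re (g s) -
    complex.Im (f s) * complex.Im (g s))); last by apply/funext => s; rewrite cReM.
  by apply: measurable_funB; exact: measurable_funM.
- rewrite (_ : (fun s => _) = (fun s => complex.Re (f s) * complex.Im (g s) +
    complex.Im (f s) * complex.Re (g s))); last by apply/funext => s; rewrite cImM.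
  by apply: measurable_funD; exact: measurable_funM.
Qed.

Lemma weighted_shift_bounded a d : continuous_periodic a ->
  bounded_operator (weighted_shift a d).
Proof.
move=> /[dup] -[ca a1] /continuous_periodic_bounded[c c0 ac].
split.
- move=> phi Lphi; have [mphi phi1 fphi] := Lphi; split.
  + apply: cmeasurableM; apply: cmeasurable_shift => //.
    exact: continuous_cmeasurable.
  + by move=> s; rewrite /weighted_shift addrAC a1 phi1.
  + apply: le_lt_trans (weighted_shift_norm_le d c0 ac Lphi) _.
    by apply: lte_mul_pinfty.
- move=> phi psi _ _ E.
  apply: (ae_imp _ (ae_translation (- d) E)) => s H _.
  by rewrite /weighted_shift H.
- move=> k phi psi _ _; apply: aeW => s _; rewrite /weighted_shift; ring.
- apply: le_lt_trans (ltry c); apply: opnorm_le => // phi Lphi.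
  exact: weighted_shift_norm_le.
Qed.

End Operators.

(** * Uniform convergence *)

Section UniformConvergence.
Context {R : realType}.
Local Notation C := R[i].
Local Notation normc := Normc.normc.
Implicit Types (f g : nat -> R -> C) (u v : R -> C) (d c s : R).

(** Uniform convergence on the line, with real-valued bounds. *)
Definition ucvg f u := forall e : R, 0 < e ->
  \forall j \near \oo, forall s, normc (f j s - u s) < e.

Lemma ucvg_uniform f u : {uniform, f j @[j --> \oo] --> u} -> ucvg f u.
Proof.
move=> fu e e0; apply: (fu [set h | forall s, normc (h s - u s) < e]).
apply/uniform_nbhs; exists [set xy | ball xy.1 e%:C xy.2]; split.
  by rewrite -entourage_from_ballE; exists e%:C => //=; rewrite ltcR.
move=> h /= hE s; have : `|u s - h s| < e%:C by have := hE s I; rewrite -ball_normE.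
by rewrite normr_normc ltcR normcB.
Qed.

Lemma ucvg_cst (l : nat -> C) l0 : l j @[j --> \oo] --> l0 ->
  ucvg (fun j _ => l j) (fun=> l0).
Proof.
by move=> /normc_cvgP ll e e0; apply: filterS (ll e e0) => j H s.
Qed.

Lemma ucvg_pt f u s : ucvg f u -> f j s @[j --> \oo] --> u s.
Proof.
by move=> fu; apply/normc_cvgP => e e0; apply: filterS (fu e e0) => j; exact.
Qed.

Lemma ucvg_shift f u d : ucvg f u -> ucvg (fun j s => f j (s + d)) (fun s => u (s + d)).
Proof. by move=> fu e e0; apply: filterS (fu e e0) => j H s. Qed.

Lemma ucvgM f u g v (A B : R) : (forall s, normc (u s) <= A) ->
  (forall s, normc (v s) <= B) -> ucvg f u -> ucvg g v ->
  ucvg (fun j s => f j s * g j s) (fun s => u s * v s).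
Proof.
move=> fA gB fu gv e e0.
have A0 : 0 <= A := le_trans (normc_ge0 _) (fA 0).
have B0 : 0 <= B := le_trans (normc_ge0 _) (gB 0).
pose t := Num.min 1 (e / (A + B + 1)).
have k0 : 0 < A + B + 1 by lra.
have t0 : 0 < t by rewrite lt_min ltr01 divr_gt0.
have t1 : t <= 1 by rewrite ge_min lexx.
have te : t * (A + B + 1) <= e.
  by rewrite -ler_pdivlMr// ge_min lexx orbT.
apply: filterS2 (fu t t0) (gv t t0) => j fj gj s.
have -> : f j s * g j s - u s * v s =
  (f j s - u s) * (g j s - v s) + (f j s - u s) * v s + u s * (g j s - v s).
  by ring.
apply: le_lt_trans (le_normcD _ _) _.
apply: le_lt_trans (lerD (le_normcD _ _) (lexx _)) _.
rewrite !Normc.normcM.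
have := fj s; have := gj s; have := fA s; have := gB s.
have := normc_ge0 (f j s - u s); have := normc_ge0 (g j s - v s).
have := normc_ge0 (u s); have := normc_ge0 (v s).
set x := normc (f j s - _); set y := normc (g j s - _).
set p := normc (u s); set q := normc (v s) => q0 p0 y0 x0 qB pA yt xt.
apply: lt_le_trans te.
have : x * y <= x by rewrite ler_piMr// ltW// (lt_le_trans yt).
have : x * q <= t * B by apply: ler_pM => //; exact: ltW.
have : p * y <= A * t by apply: ler_pM => //; exact: ltW.
lra.
Qed.

Lemma ucvgV g v c : 0 < c -> (forall s, c <= normc (v s)) -> ucvg g v ->
  ucvg (fun j s => (g j s)^-1) (fun s => (v s)^-1).
Proof.
move=> c0 cg gv e e0.
have t0 : 0 < Num.min (c / 2) (e * (c / 2) * c).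
  by rewrite lt_min divr_gt0//= !mulr_gt0.
apply: filterS (gv _ t0) => j gj s.
move: (gj s) (cg s); rewrite lt_min => /andP[gj1 gj2] cs.
have hj : c / 2 <= normc (g j s).
  have : normc (v s) <= normc (g j s - v s) + normc (g j s).
    have -> : v s = (v s - g j s) + g j s by rewrite subrK.
    by apply: le_trans (le_normcD _ _) _; rewrite normcB subrK.
  lra.
have n0 : v s != 0.
  by apply: contraTneq cs => ->; rewrite Normc.normc0 -ltNge.
have nj : g j s != 0.
  by apply: contraTneq hj => ->; rewrite Normc.normc0 -ltNge divr_gt0.
have -> : (g j s)^-1 - (v s)^-1 = (v s - g j s) / (g j s * v s).
  by field; rewrite n0.
rewrite Normc.normcM Normc.normcV Normc.normcM normcB.
have P : (c / 2) * c <= normc (g j s) * normc (v s).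
  by apply: ler_pM => //; [exact: divr_ge0 (ltW c0) _|exact: ltW].
have P0 : 0 < c / 2 * c by rewrite mulr_gt0// divr_gt0.
rewrite ltr_pdivrMr ?(lt_le_trans P0)//.
apply: lt_le_trans gj2 _; rewrite -mulrA ler_pM2l//.
Qed.

Lemma opnorm_weighted_shift_cvg (a : nat -> R -> C) a0 d : ucvg a a0 ->
  opnorm (op_sub (weighted_shift (a j) d) (weighted_shift a0 d)) @[j --> \oo] --> 0%E.
Proof.
move=> aa0.
have le_e (e : R) : 0 < e ->
    \forall j \near \oo, (opnorm (op_sub (weighted_shift (a j) d) (weighted_shift a0 d)) <= e%:E)%E.
  move=> e0; apply: filterS (aa0 e e0) => j H.
  rewrite (_ : op_sub _ _ = weighted_shift (fun s => a j s - a0 s) d); last first.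
    by apply/funext => phi; apply/funext => s; rewrite /op_sub /weighted_shift mulrBl.
  apply: opnorm_le; first exact: ltW.
  by move=> phi Lphi; apply: weighted_shift_norm_le => //; [exact: ltW|move=> s; exact: ltW].
apply/fine_cvgP; split.
  apply: filterS (le_e 1 ltr01) => j H.
  by rewrite ge0_fin_numE ?opnorm_ge0// (le_lt_trans H)// ltry.
apply/cvgrPdist_le => e e0; apply: filterS (le_e e e0) => j H.
rewrite /= sub0r normrN ger0_norm ?fine_ge0 ?opnorm_ge0//.
by rewrite -lee_fin fineK// ge0_fin_numE ?opnorm_ge0// (le_lt_trans H)// ltry.
Qed.

Lemma complex_cvg_unique (l : nat -> C) (a b : C) :
  l j @[j --> \oo] --> a -> l j @[j --> \oo] --> b -> a = b.
Proof. by apply: cvg_unique; exact: norm_hausdorff. Qed.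

Lemma complex_cvgD (a b : nat -> C) (l m : C) : a j @[j --> \oo] --> l ->
  b j @[j --> \oo] --> m -> a j + b j @[j --> \oo] --> l + m.
Proof. exact: (@cvgD C C). Qed.

Lemma complex_cvgM (a b : nat -> C) (l m : C) : a j @[j --> \oo] --> l ->
  b j @[j --> \oo] --> m -> a j * b j @[j --> \oo] --> l * m.
Proof. exact: (@cvgM C). Qed.

Lemma complex_cvgZ k (b : nat -> C) (m : C) :
  b j @[j --> \oo] --> m -> k * b j @[j --> \oo] --> k * m.
Proof. by apply: complex_cvgM; exact: cvg_cst. Qed.

Lemma complex_cvg_ext (a b : nat -> C) (l m : C) :
  a j @[j --> \oo] --> l -> a =1 b -> l = m -> b j @[j --> \oo] --> m.
Proof. by move=> + /funext <- <-. Qed.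

End UniformConvergence.

(** * The cell problem under vanishing absorption *)

Section CellLimit.
Context {R : realType}.
Local Notation C := R[i].
Local Notation normc := Normc.normc.
Local Notation Re := (@complex.Re R).
Local Notation Im := (@complex.Im R).
Implicit Types (mu rho : R -> R) (U V E : R -> C * C) (kappa : C) (L z k : R).
Local Notation rp z := (robin_plus z right_side).
Local Notation rm z := (robin_minus z right_side).

Lemma wronskian_constant L mu rho kappa U V : 0 < L ->
  solves L mu rho kappa U -> solves L mu rho kappa V ->
  wronskian U V L = wronskian U V 0.
Proof.
move=> L0 sU sV; have [cr ci] := ccont_wronskian sU sV.
have dW x : 0 < x < L -> cderiv (wronskian U V) x 0.
  by move=> xL; apply: cderiv_eq (cderiv_wronskian sU sV xL) _; rewrite subrr; ring.
have cst (f : R -> R) : {within `[0, L], continuous f} ->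
    (forall x, 0 < x < L -> is_derive x 1 f 0) -> f L = f 0.
  move=> cf df; have df' x : x \in `]0, L[ -> is_derive x 1 f 0.
    by rewrite in_itv/=; exact: df.
  have [x _] := MVT L0 df' cf.
  by rewrite mul0r => /eqP; rewrite subr_eq0 => /eqP.
have r := cst _ cr (fun x xL => (dW x xL).1).
have i := cst _ ci (fun x xL => (dW x xL).2).
by rewrite [LHS]complex_ReIm [RHS]complex_ReIm; congr (_ +i* _).
Qed.

(** Here [eta = sqrt eps] in [wronskian_increment]. *)
Lemma wronskian_vanishing_absorption L mu rho k (ep : nat -> R) (U : nat -> R -> C * C) V :
  0 < L -> (forall x, 0 < rho x) -> continuous rho ->
  (forall j, 0 < ep j) -> ep @ \oo --> 0 ->
  (forall j, solves L mu rho (k +i* ep j) (U j)) ->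
  solves L mu rho k%:C V ->
  (exists B, \forall j \near \oo, flux (U j) 0 - flux (U j) L <= B) ->
  (fun j => wronskian (U j) V L - wronskian (U j) V 0) @ \oo --> (0 : C).
Proof.
move=> L0 rho0 crho ep0 epc sU sV [B HB].
have [M0 VM0] : exists M, forall x, 0 <= x <= L -> rho x * normc (V x).1 ^+ 2 <= M.
  have [[cr ci] _ _] := sV.
  have cf : {within `[0, L], continuous (fun x => rho x *
      (Re (V x).1 * Re (V x).1 + Im (V x).1 * Im (V x).1))}.
    move=> x; apply: cvgM; first exact: (continuous_subspaceT crho).
    by apply: cvgD; apply: cvgM; [exact: cr|exact: cr|exact: ci|exact: ci].
  have /compact_bounded[M [_ HM]] := continuous_compact cf (@segment_compact R 0 L).
  have MM := HM _ (ltr_pwDr ltr01 (ler_norm M)).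
  exists (`|M| + 1) => x xL; rewrite normc_sqr !expr2.
  by apply: le_trans (ler_norm _) _; apply: MM; exists x.
pose B' := `|B|; pose M := `|M0|.
have VM x : 0 < x < L -> rho x * normc (V x).1 ^+ 2 <= M.
  by move=> xL; apply: le_trans (ler_norm _); apply: VM0; lra.
pose K := 2 * (B' + M * L / 4).
have K0 : 0 <= K.
  apply: mulr_ge0 => //; apply: addr_ge0; first exact: normr_ge0.
  by apply: divr_ge0 => //; apply: mulr_ge0; [exact: normr_ge0|exact: ltW].
apply/normc_cvgP => e e0.
have t0 : 0 < (e / (K + 1)) ^+ 2 by rewrite exprn_gt0// divr_gt0//; lra.
have /cvgrPdist_lt/(_ _ t0) ept := epc.
apply: filterS2 HB ept => j HB; rewrite sub0r normrN gtr0_norm// => ejt.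
rewrite subr0.
pose eta := Num.sqrt (ep j).
have eta0 : 0 < eta by rewrite sqrtr_gt0.
have etaE : eta ^+ 2 = ep j by rewrite sqr_sqrtr// ltW.
have := @wronskian_increment R L mu rho (k +i* ep j) k%:C (U j) V (ep j) eta M L0 rho0
  (ep0 j) eta0 erefl _ (sU j) sV VM.
move=> /(_ _)/le_lt_trans -> //.
  by apply/eqP; rewrite eq_complex/= subrr subr0 !eqxx.
have -> : ep j * M * L / (4 * eta) = eta * (M * L / 4).
  by rewrite -etaE; field; rewrite gt_eqF.
apply: (@le_lt_trans _ _ (eta * K)).
  have -> : eta * K = 2 * (eta * B' + eta * (M * L / 4)) by rewrite /K; ring.
  rewrite ler_pM2l// lerD2r ler_pM2l//.
  exact: le_trans HB (ler_norm _).
apply: (@le_lt_trans _ _ (eta * (K + 1))); first by rewrite ler_pM2l// lerDl.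
rewrite -ltr_pdivlMr; last by lra.
rewrite -ltr_sqr ?nnegrE; [|exact: ltW|by apply: divr_ge0; lra].
by rewrite etaE.
Qed.

Section Cell.
Context (z L k : R) (mu rho : R -> R) (E0 E1 : R -> C * C).
Context (z0 : 0 < z) (L0 : 0 < L) (rho0 : forall x, 0 < rho x) (crho : continuous rho).
Context (sE0 : solves L mu rho k%:C E0) (sE1 : solves L mu rho k%:C E1).
Context (E00 : rp z E0 0 = 1) (E0L : rm z E0 L = 0).
Context (E10 : rp z E1 0 = 0) (E1L : rm z E1 L = 1).

(** The Wronskian of the two cell solutions is constant, and at each end one
    of the Robin data of each solution is prescribed. *)
Lemma cell_reciprocity : rp z E0 L = rm z E1 0.
Proof.
have W := wronskian_constant L0 sE0 sE1.
have := robin_wronskian z E0 E1 L; rewrite W -robin_wronskian E00 E0L E10 E1L.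
by rewrite !mul1r !mul0r mulr1 mulr0 !subr0.
Qed.

(** Conservation of the flux of [f E0 + g E1]: the energy entering at [0] minus
    the energy leaving there is the energy leaving at [L] minus the energy
    entering there. *)
Lemma cell_energy f g :
  normc f ^+ 2 - normc (rm z E0 0 * f + rm z E1 0 * g) ^+ 2 =
  normc (rp z E0 L * f + rp z E1 L * g) ^+ 2 - normc g ^+ 2.
Proof.
pose V := lin_comb f E0 g E1.
have sV : solves L mu rho k%:C V by exact: solves_lin_comb.
have := flux_constant L0 (erefl : Im k%:C = 0) sV.
move=> /(congr1 (fun y => 4 * z * y)); rewrite -!robin_flux.
rewrite !robin_plus_comb !robin_minus_comb E00 E10 E0L E1L !mulr0 !mulr1 addr0 add0r.
by rewrite [f * _]mulrC [g * _]mulrC [f * rm _ _ _]mulrC [g * rm _ _ _]mulrC => <-.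
Qed.

(** Pairing [f j * u j] with [E0] and with [E1] gives its two outgoing data, the
    coefficient [rp E0 L] appearing as [rm E1 0] by reciprocity. *)
Lemma cell_vanishing_absorption (ep : nat -> R) (u : nat -> R -> C * C)
    (f g : nat -> C) f0 g0 :
  (forall j, 0 < ep j) -> ep @ \oo --> 0 ->
  (forall j, solves L mu rho (k +i* ep j) (u j)) ->
  (forall j, rp z (u j) 0 = 1) -> (forall j, g j = rm z (u j) L * f j) ->
  f j @[j --> \oo] --> f0 -> g j @[j --> \oo] --> g0 ->
  (rm z (u j) 0 * f j @[j --> \oo] --> rm z E0 0 * f0 + rm z E1 0 * g0) /\
  (rp z (u j) L * f j @[j --> \oo] --> rp z E0 L * f0 + rp z E1 L * g0).
Proof.
move=> ep0 epc su u0 uL ff gg.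
pose v j := lin_comb (f j) (u j) 0 (u j).
have sv j : solves L mu rho (k +i* ep j) (v j) by exact: solves_lin_comb.
have rpv x j : rp z (v j) x = rp z (u j) x * f j.
  by rewrite robin_plus_comb mul0r addr0 mulrC.
have rmv x j : rm z (v j) x = rm z (u j) x * f j.
  by rewrite robin_minus_comb mul0r addr0 mulrC.
(* The flux drop is an expression in Robin data; the squared outgoing data
   enter it with a favourable sign, and the incoming ones converge. *)
have vB : exists B, \forall j \near \oo, flux (v j) 0 - flux (v j) L <= B.
  exists (((normc f0 + 1) ^+ 2 + (normc g0 + 1) ^+ 2) / (4 * z)).
  have /normc_cvgP/(_ 1 ltr01) ff1 := ff; have /normc_cvgP/(_ 1 ltr01) gg1 := gg.
  apply: filterS2 ff1 gg1 => j fj gj.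
  rewrite ler_pdivlMr ?mulr_gt0// mulrBl [_ * (4 * z)]mulrC [flux (v j) L * _]mulrC.
  rewrite -!robin_flux !rpv !rmv u0 mul1r -uL.
  have bnd (a b : C) : normc (a - b) < 1 -> normc a ^+ 2 <= (normc b + 1) ^+ 2.
    move=> ab; rewrite lerXn2r ?nnegrE ?normc_ge0 ?addr_ge0 ?normc_ge0//.
    rewrite -[a](subrK b); apply: le_trans (le_normcD _ _) _.
    by rewrite addrC lerD2l ltW.
  have := bnd _ _ fj; have := bnd _ _ gj.
  have := sqr_ge0 (normc (rm z (u j) 0 * f j)).
  have := sqr_ge0 (normc (rp z (u j) L * f j)); lra.
have lim V : solves L mu rho k%:C V ->
    ((rp z (v j) L * rm z V L - rm z (v j) L * rp z V L) -
     (rp z (v j) 0 * rm z V 0 - rm z (v j) 0 * rp z V 0)) @[j --> \oo] --> (0 : C).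
  move=> sV; have W := wronskian_vanishing_absorption L0 rho0 crho ep0 epc sv sV vB.
  apply: (complex_cvg_ext (@complex_cvgZ R (2 * (0 +i* z)) _ _ W)) => [j|]; last by rewrite mulr0.
  by rewrite !robin_wronskian -mulrBr.
have cfg (a b : C) : a * f j + b * g j @[j --> \oo] --> a * f0 + b * g0.
  by apply: complex_cvgD; exact: complex_cvgZ.
split.
- apply: (complex_cvg_ext (complex_cvgD (lim _ sE0) (cfg (rm z E0 0) (rm z E1 0)))) => [j|].
    by rewrite !rpv !rmv u0 -uL E00 E0L cell_reciprocity; ring.
  by rewrite add0r.
- apply: (complex_cvg_ext (complex_cvgD (lim _ sE1) (cfg (rp z E0 L) (rp z E1 L)))) => [j|].
    by rewrite !rpv !rmv u0 -uL E10 E1L cell_reciprocity; ring.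
  by rewrite add0r.
Qed.

End Cell.
End CellLimit.

(** * Nonvanishing of the limit eigenfunction *)

Section Nonvanishing.
Context {R : realType}.
Local Notation C := R[i].
Local Notation normc := Normc.normc.

Lemma normc_le_cvg (a b : nat -> C) l m : a j @[j --> \oo] --> l ->
  b j @[j --> \oo] --> m -> (forall j, normc (a j) <= normc (b j)) ->
  normc l <= normc m.
Proof.
move=> /normc_cvgP al /normc_cvgP bm ab; rewrite leNgt; apply/negP => ml.
have e0 : 0 < (normc l - normc m) / 2 by lra.
have [j [/= aj bj]] := filter_ex (filterI (al _ e0) (bm _ e0)).
have := ab j.
have := le_normcD (l - a j) (a j); rewrite subrK normcB.
have := le_normcD (b j - m) m; rewrite subrK.
lra.
Qed.

(** [Q = |phi|^2 - |a|^2] does not decrease along [s, s + d, s + 2 d], and so on,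
    because [|l| <= 1], so [|phi|^2] is at least [Q(0)] on a dense set. *)
Lemma nonvanishing_limit d (l : C) (phi a : R -> C) : irrational d ->
  continuous_periodic phi -> normc l <= 1 ->
  (forall s, normc (a s) <= normc (phi s)) ->
  (forall s, normc (phi s) ^+ 2 - normc (a s) ^+ 2 =
    normc l ^+ 2 * (normc (phi (s + d)) ^+ 2 - normc (a (s + d)) ^+ 2)) ->
  normc (phi 0) ^+ 2 - normc (a 0) ^+ 2 != 0 ->
  exists2 c, 0 < c & forall s, c <= normc (phi s).
Proof.
move=> dirr [cphi phi1] l1 aphi Qinv Q0.
pose Q s := normc (phi s) ^+ 2 - normc (a s) ^+ 2.
have Q_ge0 s : 0 <= Q s.
  by rewrite subr_ge0 lerXn2r ?nnegrE ?normc_ge0.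
have Q0_gt0 : 0 < Q 0 by rewrite lt_neqAle eq_sym Q0 Q_ge0.
have Qorb n : Q 0 <= Q (n%:R * d).
  elim: n => [|n IH]; first by rewrite mul0r.
  apply: le_trans IH _; rewrite /Q Qinv -natr1 mulrDl mul1r -/(Q _).
  by rewrite ler_piMl// ?Q_ge0// -[leRHS](expr1n _ 2) lerXn2r ?nnegrE ?normc_ge0.
have porb n (k : int) : Q 0 <= normc (phi (n%:R * d + k%:~R)) ^+ 2.
  rewrite periodic_int//; apply: le_trans (Qorb n) _.
  by rewrite gerBl sqr_ge0.
have pall s : Q 0 <= normc (phi s) ^+ 2.
  rewrite leNgt; apply/negP => sQ.
  pose h t := normc (phi t).
  have s0 : 0 < (Num.sqrt (Q 0) - h s) / 2.
    rewrite divr_gt0// subr_gt0 -[h s]ger0_norm ?normc_ge0// -sqrtr_sqr.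
    by rewrite ltr_sqrt.
  have : nbhs s [set t | normc (phi t - phi s) < (Num.sqrt (Q 0) - h s) / 2].
    exact: (@normc_cvgP R _ (nbhs s) _ phi (phi s)).1 (cphi s) _ s0.
  move=> /nbhs_ballP[e /= e0 he].
  have [n [k nk]] := orbit_dense s dirr e0.
  have := he (n%:R * d + k%:~R); rewrite /ball/= distrC => /(_ nk).
  have hQ : Num.sqrt (Q 0) <= h (n%:R * d + k%:~R).
    by rewrite -[h _]ger0_norm ?normc_ge0// -sqrtr_sqr ler_sqrt ?sqr_ge0// porb.
  move: hQ s0; rewrite /h; set x := phi (_ + _).
  have := le_normcD (x - phi s) (phi s); rewrite subrK; lra.
exists (Num.sqrt (Q 0)); first by rewrite sqrtr_gt0.
by move=> s; rewrite -[normc _]ger0_norm ?normc_ge0// -sqrtr_sqr ler_sqrt// ?sqr_ge0.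
Qed.

(** The real part of [(p - a) conj (p + a)] is [|p|^2 - |a|^2]. *)
Lemma flux_densityE (t0 t1 : R -> C) d (phi psi : R -> C) s :
  flux_density t0 t1 d phi psi s =
  normc (phi s) ^+ 2 - normc (t0 s * phi s + t1 s * psi (s + d)) ^+ 2.
Proof.
rewrite /flux_density; set a := t0 s * phi s; set b := t1 s * _.
rewrite !mulrDl mulNr !mul1r -/a !normc_sqr.
case: (phi s) => p1 p2; case: {+}a => a1 a2; case: b => b1 b2 /=; ring.
Qed.

End Nonvanishing.

(** * The limit operators and the Riccati system *)

Theorem proposition5p19 (R : realType)
  (mu_p rho_p : R * R -> R) (theta1 theta2 delta z omega : R) (m : nat)
  (hmu : periodic_coefficient mu_p) (hrho : periodic_coefficient rho_p)
  (htheta2 : 0 < theta2) (hdelta : delta = theta1 / theta2)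
  (hirr : irrational delta) (hz : 0 < z)
  (hmeasure_fin : (irrationality_measure delta < +oo)%E)
  (hm : (irrationality_measure delta < m%:R%:E)%E)
  (hmuC : Ck2 m mu_p) (hrhoC : Ck2 m rho_p)
  (mu := coef theta1 theta2 mu_p) (rho := coef theta1 theta2 rho_p)
  (hspec : spectrum (rho 0) (sturm_liouville (mu 0) (rho 0)) (omega ^+ 2)%:C)
  (* fundamental solutions, indexed by side, absorption and s *)
  (u : side -> R -> R -> R -> R[i] * R[i])
  (hu : forall i eps s, 0 < eps ->
    fundamental_solution z i (mu s) (rho s) (omega ^+ 2 +i* eps) (u i eps s))
  (p := fun i eps s => robin_plus z i (u i eps s) (cell_end theta2 i))
  (sigma := fun i eps s => robin_minus z i (u i eps s) (cell_end theta2 i))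
  (P_ := fun i eps => weighted_shift (p i eps) (sgn i * delta))
  (S_ := fun i eps => weighted_shift (sigma i eps) (sgn i * delta))
  (* fundamental eigenpairs *)
  (lam : side -> R -> R[i]) (phi : side -> R -> R -> R[i])
  (heig : forall i eps, 0 < eps -> eigenpair (P_ i eps) (lam i eps) (phi i eps))
  (psi := fun i eps => S_ i eps (phi i eps))
  (* cell solutions without absorption *)
  (e : side -> bool -> R -> R -> R[i] * R[i])
  (he : forall i b s,
    cell_solution theta2 z i b (mu s) (rho s) (omega ^+ 2)%:C (e i b s))
  (t00 := fun i s => robin_minus z i (e i false s) 0)
  (t01 := fun i s => robin_plus z i (e i false s) (cell_end theta2 i))
  (t10 := fun i s => robin_minus z i (e i true s) 0)
  (t11 := fun i s => robin_plus z i (e i true s) (cell_end theta2 i))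
  (T00 : operator := fun f s => t00 right_side s * f s)
  (T01 : operator := fun f s => t01 right_side (s - delta) * f (s - delta))
  (T10 : operator := fun f s => t10 right_side s * f (s + delta))
  (T11 : operator := fun f s => t11 right_side (s - delta) * f s)
  (* omega is a regular frequency *)
  (eps : nat -> R) (lam0 : side -> R[i]) (phi0 psi0 : side -> R -> R[i])
  (hreg : regular_along delta t00 t10 lam phi psi eps lam0 phi0 psi0)
  (Plim := weighted_shift (fun s => lam0 right_side
          * phi0 right_side (s + delta) / phi0 right_side s) delta)
  (Slim := weighted_shift (fun s =>
          psi0 right_side (s + delta) / phi0 right_side s) delta) :
  (exists g : nat -> nat,
    [/\ {homo g : j k / (j < k)%N},
        opnorm (op_sub (P_ right_side (eps (g j))) Plim) @[j --> \oo] --> 0%E &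
        opnorm (op_sub (S_ right_side (eps (g j))) Slim) @[j --> \oo] --> 0%E])
  /\ [/\ bounded_operator Plim, bounded_operator Slim,
         op_eq Plim (op_add T01 (T11 \o Slim)) &
         op_eq Slim (op_add (T00 \o Plim) (T10 \o Slim \o Plim))].
Proof.
have mu_cont f s : continuous f -> continuous (coef theta1 theta2 f s).
  move=> cf x; apply: (@continuous_comp _ _ _ (fun x => (s + theta1 * x, theta2 * x)) f); last exact: cf.
  have lin (k : R) : k * y @[y --> x] --> k * x.
    by apply: cvgM; [exact: cvg_cst|exact: cvg_id].
  have aff : s + theta1 * y @[y --> x] --> s + theta1 * x.
    by apply: cvgD; [exact: cvg_cst|exact: lin].
  exact: (cvg_pair aff (lin theta2)).
have [cmu_p mu1 mu2 [cm cm0 mu_ge]] := hmu.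
have [crho_p rho1 rho2 [cr cr0 rho_ge]] := hrho.
have [M muM] := periodic2_bounded cmu_p mu1 mu2.
have cmu s : continuous (mu s) by exact: mu_cont.
have crho s : continuous (rho s) by exact: mu_cont.
have mu_gt0 s x : 0 < mu s x by exact: lt_le_trans cm0 (mu_ge _).
have mu_le s x : 0 < mu s x <= M by rewrite mu_gt0 /mu /coef muM.
have rho_gt0 s x : 0 < rho s x by exact: lt_le_trans cr0 (rho_ge _).
pose L := theta2^-1.
have L0 : 0 < L by rewrite invr_gt0.
(* A step of [1 / theta2] is one period in the second variable and moves the
   first one by [delta]. *)
have coefL f s : (forall x y, f (x, y + 1) = f (x, y)) ->
    (fun x => coef theta1 theta2 f s (x + L)) = coef theta1 theta2 f (s + delta).
  move=> f1; apply/funext => x; rewrite /coef /L hdelta -(f1 _ (theta2 * x)).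
  by congr (f (_, _)); field; rewrite gt_eqF.
have muL s : (fun x => mu s (x + L)) = mu (s + delta) by exact: coefL.
have rhoL s : (fun x => rho s (x + L)) = rho (s + delta) by exact: coefL.
have endL : cell_end theta2 right_side = L :> R by rewrite /cell_end/= mul1r.
have sgnd : sgn right_side * delta = delta by rewrite /= mul1r.
have [eps_gt0 eps0 hlim] := hreg.
have [lamc [cphi0 cpsi0] phic psic Q0] := hlim right_side.
set l0 := lam0 right_side in lamc Plim *.
set f0 := phi0 right_side in cphi0 phic Q0 Plim Slim *.
set g0 := psi0 right_side in cpsi0 psic Q0 Slim *.
pose uj j s := u right_side (eps j) s.
pose fj j s := phi right_side (eps j) s.
pose gj j s := psi right_side (eps j) s.
pose lj j := lam right_side (eps j).
pose rp := robin_plus z right_side.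
pose rm := robin_minus z right_side.
pose e0 s := e right_side false s; pose e1 s := e right_side true s.
have su j s T : 0 < T -> solves T (mu s) (rho s) (omega ^+ 2 +i* eps j) (uj j s).
  move=> T0; have [wu _] := hu right_side (eps j) s (eps_gt0 j).
  apply: (weak_solution_solves _ T0 _ (cmu s) (mu_gt0 s) (crho s) wu).
    exact: interval_open.
  by move=> x /=; rewrite !in_itv/= andbT => /andP[].
have uj1 j s : rp (uj j s) 0 = 1 by have [] := hu right_side (eps j) s (eps_gt0 j).
have dens j s := weak_solution_density (cmu s) (mu_le s) (hu right_side (eps j) s (eps_gt0 j)).1.
have se b s : solves L (mu s) (rho s) (omega ^+ 2)%:C (e right_side b s).
  have [we _ _] := he right_side b s.
  apply: (weak_solution_solves _ L0 _ (cmu s) (mu_gt0 s) (crho s) we).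
    exact: interval_open.
  by move=> x.
have e00 s : rp (e0 s) 0 = 1 by have [_ H _] := he right_side false s; exact: H.
have e10 s : rp (e1 s) 0 = 0 by have [_ H _] := he right_side true s; exact: H.
have e0L s : rm (e0 s) L = 0.
  by have [_ _ H] := he right_side false s; rewrite endL in H; exact: H.
have e1L s : rm (e1 s) L = 1.
  by have [_ _ H] := he right_side true s; rewrite endL in H; exact: H.
(* [A] is the outgoing datum at [0] of the solution with incoming datum [phi],
   and [a] will be its limit. *)
pose A j s := rm (uj j s) 0 * fj j s.
pose a s := t00 right_side s * f0 s + t10 right_side s * g0 (s + delta).
have eigE j s : rp (uj j s) L * fj j s = lj j * fj j (s + delta).
  have [_ _ _ _ /(_ (s + delta))] := heig right_side (eps j) (eps_gt0 j).
  by rewrite /P_ /weighted_shift sgnd addrK /p endL.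
have psiE j s : gj j (s + delta) = rm (uj j s) L * fj j s.
  by rewrite /gj /psi /S_ /weighted_shift sgnd addrK /sigma endL.
have phi_neq0 j s : fj j s != 0.
  by have [_ [_ H] _ _ _] := heig right_side (eps j) (eps_gt0 j); exact: H.
have im_ge0 j : 0 <= complex.Im (omega ^+ 2 +i* eps j) := ltW (eps_gt0 j).
(* [x |-> u_s(x + L)] solves the equation of [s + delta]. *)
have outE j s : rm (uj j s) L = rp (uj j s) L * rm (uj j (s + delta)) 0.
  pose U x := uj j s (x + L).
  have U0 : U 0 = uj j s L by rewrite /U add0r.
  have rpU : rp U 0 = rp (uj j s) L by rewrite /rp /robin_plus U0.
  have rmU : rm U 0 = rm (uj j s) L by rewrite /rm /robin_minus U0.
  rewrite -rmU -rpU.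
  have [mU iU] := dens j s; have [mV iV] := dens j (s + delta).
  have [mU' iU'] := density_translation (ltW L0) mU iU.
  have sU T : 0 < T ->
      solves T (mu (s + delta)) (rho (s + delta)) (omega ^+ 2 +i* eps j) U.
    by move=> T0; rewrite -muL -rhoL; apply: solves_translation => //; exact: su.
  exact: (robin_minus_proportional hz (rho_gt0 (s + delta)) (im_ge0 j) sU
    (su j (s + delta)) mU' iU' mV iV (uj1 j (s + delta))).
have flux0 j s : Normc.normc (A j s) <= Normc.normc (fj j s).
  have f_ge0 : 0 <= flux (uj j s) 0.
    have [mU iU] := dens j s.
    apply: (flux_ge0 (rho_gt0 s) (im_ge0 j) (su j s) mU iU).
    by move=> x _; exact: flux_le_density.
  have := robin_flux z (uj j s) 0; rewrite -/rp -/rm uj1 Normc.normc1 expr1n => E.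
  rewrite /A Normc.normcM ler_piMl ?normc_ge0//.
  rewrite -ler_sqr ?nnegrE ?normc_ge0// expr1n -subr_ge0 E.
  by rewrite mulr_ge0// mulr_ge0// ltW.
have fcv s : fj j s @[j --> \oo] --> f0 s by exact: ucvg_pt (ucvg_uniform phic).
have gcv s : gj j s @[j --> \oo] --> g0 s by exact: ucvg_pt (ucvg_uniform psic).
have cell s := cell_vanishing_absorption hz L0 (rho_gt0 s) (crho s)
  (se false s) (se true s) (e00 s) (e0L s) (e10 s) (e1L s) eps_gt0 eps0
  (fun j => su j s L L0) (uj1 ^~ s) (psiE ^~ s) (fcv s) (gcv (s + delta)).
have Acv s : A j s @[j --> \oo] --> a s by exact: (cell s).1.
have outcv s : l0 * f0 (s + delta) =
    t01 right_side s * f0 s + t11 right_side s * g0 (s + delta).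
  rewrite /t01 /t11 endL; apply: complex_cvg_unique (cell s).2.
  apply: (complex_cvg_ext (complex_cvgM lamc (fcv (s + delta)))); last by [].
  by move=> j; rewrite -eigE.
have incv s : g0 (s + delta) = l0 * a (s + delta).
  apply: (complex_cvg_unique (gcv (s + delta))).
  apply: (complex_cvg_ext (complex_cvgM lamc (Acv (s + delta)))); last by [].
  by move=> j; rewrite psiE outE mulrAC eigE /A -mulrA; congr (_ * _); rewrite mulrC.
have a_le s : Normc.normc (a s) <= Normc.normc (f0 s).
  exact: normc_le_cvg (Acv s) (fcv s) (flux0 ^~ s).
have l0_le1 : Normc.normc l0 <= 1.
  rewrite -(@Normc.normc1 R); apply: (normc_le_cvg lamc (cvg_cst (1 : R[i]))) => j.
  rewrite Normc.normc1.
  have [+ _ _ _ _] := heig right_side (eps j) (eps_gt0 j).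
  by rewrite normr_normc -[1]/((1 : R)%:C) ltcR => /ltW.
have energy s : Normc.normc (f0 s) ^+ 2 - Normc.normc (a s) ^+ 2 =
    Normc.normc l0 ^+ 2 * (Normc.normc (f0 (s + delta)) ^+ 2 - Normc.normc (a (s + delta)) ^+ 2).
  have := cell_energy L0 (se false s) (se true s) (e00 s) (e0L s) (e10 s) (e1L s)
    (f0 s) (g0 (s + delta)).
  have := outcv s; rewrite /t01 /t11 endL => <- E; apply: etrans E _.
  by rewrite incv !Normc.normcM !exprMn mulrBr.
(* By [flux_densityE] this is the flux density at [0], which regularity of the
   frequency makes nonzero. *)
have Q0' : Normc.normc (f0 0) ^+ 2 - Normc.normc (a 0) ^+ 2 != 0.
  by move: Q0; rewrite flux_densityE sgnd.
have [c c0 fc] := nonvanishing_limit hirr cphi0 l0_le1 a_le energy Q0'.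
have f0_neq0 s : f0 s != 0.
  by apply: contraTneq (fc s) => ->; rewrite Normc.normc0 -ltNge.
have [F F_ge0 fF] := continuous_periodic_bounded cphi0.
have [G G_ge0 gG] := continuous_periodic_bounded cpsi0.
have fcu : ucvg (fun j s => fj j s) f0 := ucvg_uniform phic.
have gcu : ucvg (fun j s => gj j s) g0 := ucvg_uniform psic.
have fVcu := ucvgV c0 fc fcu.
have fVb s : Normc.normc (f0 s)^-1 <= c^-1.
  by rewrite Normc.normcV lef_pV2 ?posrE//; exact: lt_le_trans c0 (fc s).
have numer_b s : Normc.normc (l0 * f0 (s + delta)) <= F.
  by rewrite Normc.normcM -[leRHS]mul1r ler_pM ?normc_ge0.
have pcu : ucvg (fun j s => p right_side (eps j) s)
    (fun s => l0 * f0 (s + delta) / f0 s).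
  have H := ucvgM (fun=> l0_le1) (fun s => fF (s + delta)) (ucvg_cst lamc) (ucvg_shift delta fcu).
  have := ucvgM numer_b fVb H fVcu.
  congr ucvg; apply/funext => j; apply/funext => s.
  by rewrite -[lam _ _]/(lj j) -eigE mulfK// /p endL.
have scu : ucvg (fun j s => sigma right_side (eps j) s)
    (fun s => g0 (s + delta) / f0 s).
  have := ucvgM (fun s => gG (s + delta)) fVb (ucvg_shift delta gcu) fVcu.
  congr ucvg; apply/funext => j; apply/funext => s.
  by rewrite psiE mulfK// /sigma endL.
have quot_cp (h : R -> R[i]) : continuous_periodic h ->
    continuous_periodic (fun s => h (s + delta) / f0 s).
  move=> [ch h1]; have [cf f1] := cphi0; split; last first.
    by move=> s; rewrite f1 addrAC h1.
  move=> s; apply: (@cvgM R[i]).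
    apply: (@continuous_comp _ _ _ (fun s => s + delta) h); last exact: ch.
    by apply: cvgD; [exact: cvg_id|exact: cvg_cst].
  by apply: (@cvgV R[i]); [exact: f0_neq0|exact: cf].
have cpP : continuous_periodic (fun s => l0 * f0 (s + delta) / f0 s).
  apply: (quot_cp (fun s => l0 * f0 s)); have [cf f1] := cphi0; split.
    by move=> s; apply: (@cvgM R[i]); [exact: cvg_cst|exact: cf].
  by move=> s; rewrite f1.
split.
  (* The full sequence converges. *)
  exists id; split=> //.
  - by rewrite /P_ sgnd; exact: opnorm_weighted_shift_cvg pcu.
  - by rewrite /S_ sgnd; exact: opnorm_weighted_shift_cvg scu.
split.
- exact: weighted_shift_bounded cpP.
- exact: weighted_shift_bounded (quot_cp _ cpsi0).
- move=> h _; apply: aeW => s _.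
  rewrite /op_add /T01 /T11 /Plim /Slim /weighted_shift/= outcv.
  by field; exact: f0_neq0.
- move=> h _; apply: aeW => s _.
  rewrite /op_add /T00 /T10 /Plim /Slim /weighted_shift/= !addrK !subrK.
  have -> : g0 s = l0 * a s by rewrite -[in LHS](subrK delta s) incv subrK.
  rewrite /a.
  by field; rewrite !f0_neq0.
Qed.
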